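(* Let $\alpha=\frac15$ and let $u$ be an axially symmetric solution of $$\alpha P_4u+6\left(1-\frac{e^{4u}}{\int_{\mathbb S^4}e^{4u}dw}\right)=0\quad\text{on }\mathbb S^4 .$$ Then $u$ is constant.
   Context: $\mathbb S^4\subset\mathbb R^5$ is the unit sphere with points $\xi=(\xi_1,\dots,\xi_5)$; $dw$ is the volume form normalized so that $\int_{\mathbb S^4}dw=1$; $P_4=\Delta^2-2\Delta$ is the Paneitz operator, $\Delta$ being the Laplace–Beltrami operator. Axially symmetric means depending only on $\xi_1$. Solutions are understood to be in $H^2(\mathbb S^4)$ (weak, hence smooth, solutions on all of $\mathbb S^4$). *)

(* Defs.v *)
From HB Require Import structures.
From mathcomp Require Import all_boot all_order all_algebra.
From mathcomp Require Import all_classical all_reals all_analysis.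

Set Implicit Arguments.
Unset Strict Implicit.
Unset Printing Implicit Defensive.

Import Order.TTheory GRing.Theory Num.Theory.
Import numFieldNormedType.Exports.

Local Open Scope classical_set_scope.
Local Open Scope ring_scope.

(* A function on S^4 is represented by a function on R^5 = 'rV[R]_5, of which
   only the values on S^4 are used.  The paper's xi_1, ..., xi_5 are the
   entries x 0 0, ..., x 0 4 of x : 'rV[R]_5. *)

Section Sphere.
Context {R : realType}.
Local Notation angles := (measurableTypeR R * measurableTypeR R *
                           measurableTypeR R * measurableTypeR R)%type.
Implicit Types (t : angles) (u v f : 'rV[R]_5 -> R)
  (phi : 'rV[R]_5 -> R) (x : 'rV[R]_5).

(* Polar coordinates on S^4.  The round metric is
   dt1^2 + sin(t1)^2 (dt2^2 + sin(t2)^2 (dt3^2 + sin(t3)^2 dt4^2)),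
   whence its volume density sin(t1)^3 sin(t2)^2 sin(t3). *)

Definition polar_domain : set angles :=
  `[0, pi] `*` `[0, pi] `*` `[0, pi] `*` `[0, 2 * pi].

Definition polar t : 'rV[R]_5 :=
  let: (t1, t2, t3, t4) := t in
  \row_(i < 5)
    [:: cos t1;
        sin t1 * cos t2;
        sin t1 * sin t2 * cos t3;
        sin t1 * sin t2 * sin t3 * cos t4;
        sin t1 * sin t2 * sin t3 * sin t4]`_i.

Definition polar_density t : R :=
  let: (t1, t2, t3, t4) := t in sin t1 ^+ 3 * sin t2 ^+ 2 * sin t3.

Definition leb4 : {measure set angles%type -> \bar R} :=
  (@lebesgue_measure R \x @lebesgue_measure R \x
   @lebesgue_measure R \x @lebesgue_measure R)%E.

(* The integral of f against the volume form dw of S^4, of total mass 1. *)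
Definition sphere_int f : R :=
  Rintegral leb4 polar_domain (fun t => f (polar t) * polar_density t) /
  Rintegral leb4 polar_domain polar_density.

(* The volume density is positive off a negligible subset of polar_domain, so
   null sets for dw are the null sets for leb4 in these coordinates. *)
Definition sphere_ae (P : 'rV[R]_5 -> Prop) : Prop :=
  {ae leb4, forall t, polar_domain t -> P (polar t)}.

Definition sphere_L2 f : Prop :=
  measurable_fun polar_domain (f \o polar) /\
  leb4.-integrable polar_domain
    (EFin \o (fun t => f (polar t) ^+ 2 * polar_density t)).

Definition pderiv (i : 'I_5) phi : 'rV[R]_5 -> R :=
  fun x => 'D_(delta_mx 0 i) phi x.

Fixpoint Ck (k : nat) phi : Prop :=
  continuous phi /\
  if k is k'.+1 then
    forall i : 'I_5,
      (forall x, derivable phi x (delta_mx 0 i)) /\ Ck k' (pderiv i phi)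
  else True.

(* The restrictions to S^4 of these functions are exactly the smooth functions
   on S^4. *)
Definition smooth phi : Prop := forall k, Ck k phi.

(* The i-th Euclidean component of the gradient on S^4, i.e. of the projection
   of the gradient in R^5 to the tangent space at x.  At a point of S^4 it only
   depends on the restriction of phi to S^4. *)
Definition tderiv (i : 'I_5) phi : 'rV[R]_5 -> R :=
  fun x => pderiv i phi x - x 0 i * \sum_(j < 5) x 0 j * pderiv j phi x.

(* Laplace-Beltrami operator, as div grad: the divergence on S^4 of a tangent
   field (V_0, ..., V_4) is the sum of the tderiv i V_i. *)
Definition laplace_beltrami phi : 'rV[R]_5 -> R :=
  fun x => \sum_(i < 5) tderiv i (tderiv i phi) x.

Definition paneitz phi : 'rV[R]_5 -> R :=
  fun x => laplace_beltrami (laplace_beltrami phi) x -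
           2 * laplace_beltrami phi x.

(* v is the weak tangential derivative of u.  The zeroth order term comes from
   the mean curvature of S^4 in R^5: for smooth phi, the integral of
   tderiv i phi over S^4 is that of 4 * x_i * phi. *)
Definition weak_tderiv (i : 'I_5) u v : Prop :=
  forall phi, smooth phi ->
    sphere_int (fun x => u x * (tderiv i phi x - 4 * x 0 i * phi x)) =
    - sphere_int (fun x => v x * phi x).

(* The Sobolev space H^2(S^4). *)
Definition sphere_H2 u : Prop :=
  sphere_L2 u /\
  forall i, exists v, [/\ sphere_L2 v, weak_tderiv i u v &
    forall j, exists w, sphere_L2 w /\ weak_tderiv j v w].

Definition axially_symmetric u : Prop :=
  exists g : R -> R, sphere_ae (fun x => u x = g (x 0 0)).

(* u solves alpha P_4 u + 6 (1 - e^{4u} / \int e^{4u} dw) = 0 weakly on S^4;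
   P_4 is formally self-adjoint.  For u in H^2(S^4) the function e^{4u} is
   integrable (Adams' inequality), so that all the integrals converge. *)
Definition weak_solution (alpha : R) u : Prop :=
  forall phi, smooth phi ->
    alpha * sphere_int (fun x => u x * paneitz phi x) +
    6 * sphere_int (fun x =>
      (1 - expR (4 * u x) / sphere_int (fun y => expR (4 * u y))) * phi x) = 0.

End Sphere.

(* Main.v *)
From HB Require Import structures.
Require Import Defs.
From mathcomp Require Import all_boot all_order all_algebra.
From mathcomp Require Import all_classical all_reals all_analysis.
From mathcomp Require Import measurable_realfun ring lra.

Set Implicit Arguments.
Unset Strict Implicit.
Unset Printing Implicit Defensive.

Import Order.TTheory GRing.Theory Num.Theory.
Import numFieldNormedType.Exports.

Local Open Scope classical_set_scope.
Local Open Scope ring_scope.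

(* Let x = xi_1 = cos t.  On zonal functions P_4 u = ((1 - x^2)^2 u')''', so with
   F = (1 - x^2)^2 u' the equation reads F''' = C e^{4u} - 30 on ]-1, 1[.

   For a smooth solution, multiply by x F: the left-hand side integrates to
   3/2 int F'^2, while C e^{4u} F = (1 - x^2)^2 (C e^{4u})' / 4 turns the
   right-hand side, after integration by parts, into a multiple of
   int (1 - x^2) (1 - 5 x^2) F''' + 120 x F = 0.  The two linear terms cancel
   exactly because 1 - 5 x^2 spans the eigenspace of P_4 for the eigenvalue
   120 = 24 / alpha.  Hence F' = 0, F = 0 and u is constant.

   For a weak solution only the zonal polynomials p(xi_1) are used as test
   functions.  With N(x) = int_{-1}^x (C e^{4u} - 30) (1 - y^2) dy, which is
   merely continuous, a Green function for (1 - x^2) F'' + 2 x F' - 2 F = N with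
   F(-1) = F(1) = 0 provides V with (1 - x^2)^2 V' = F that satisfies the same
   weak equation as u.  The moments of u - V against all polynomials then agree
   with those of a constant, so u = V + c almost everywhere, and u is regular
   enough for the computation above; the boundary terms vanish because
   F = o(1 - x^2) and F' = o(1) at the poles.  If e^{4u} were not integrable, its
   [sphere_int] would be 0, as well as the quotient by it: this is C = 0. *)

(** * Zonal functions on the sphere *)

(** The volume of S^4 has density sin^3 t in t, that is (1 - x^2) dx, and this weight makes the
    equation exact: the derivative of (1 - x^2) F'' + 2 x F' - 2 F is (1 - x^2) F'''. One
    integration thus replaces the third-order equation by a second-order one whose right-hand side N
    is continuous as soon as e^{4u} is integrable; this takes the place of elliptic regularity. N
    vanishes at x = -1 by definition and at x = 1 by the test function 1. The homogeneous solutions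
    (1 - x)^2 and (1 + x)^2 vanish to second order at one pole each, which leaves exactly the
    freedom to impose F = 0 at both. A solution might a priori be singular at the poles. F = o(1 -
    x^2) gives dV/dt = o(1 / sin t), so V grows more slowly than any multiple of log (1 / sin t),
    and e^{4V} sin^3 t still tends to 0. Once u = V + c almost everywhere, N is the integral of a
    continuous function, hence differentiable, and F''' exists. *)

Section calculus.
Context {R : realType}.

Lemma is_derive_coord (k : 'I_5) (x v : 'rV[R]_5) :
  is_derive x v (fun y : 'rV[R]_5 => y 0 k) (v 0 k).
Proof.
have E (h : R) : h != 0 -> h^-1 *: ((h *: v + x) 0 k - x 0 k) = v 0 k.
  by move=> h0; rewrite !mxE addrK /GRing.scale /= mulKf.
have H : h^-1 *: ((h *: v + x) 0 k - x 0 k) @[h --> 0^'] --> v 0 k.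
  apply: cvg_near_cst; near=> h; apply: E; near: h; exact: nbhs_dnbhs_neq.
split; first by apply: cvgP H.
exact: (cvg_lim _ H).
Unshelve. all: by end_near. Qed.

Lemma is_derive_horner (V : normedModType R) (f : V -> R) (x v : V) (df : R)
    (p : {poly R}) : is_derive x v f df ->
  is_derive x v (fun y => p.[f y]) (p^`().[f x] * df).
Proof.
move=> fx; elim/poly_ind: p => [|p c ih].
  rewrite deriv0 horner0 mul0r.
  rewrite (_ : (fun _ => _) = cst 0); first exact: is_derive_cst.
  by apply/funext => y; rewrite horner0.
rewrite (_ : (fun _ => _) = (fun y => p.[f y]) * f + cst c); last first.
  by apply/funext => y; rewrite hornerMXaddC.
apply: is_derive_eq.
by rewrite derivMXaddC !hornerE /GRing.scale /=; ring.
Qed.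

Definition zonal (p : {poly R}) : 'rV[R]_5 -> R := fun x => p.[x 0 0].

Lemma is_derive_zonal p (x v : 'rV[R]_5) :
  is_derive x v (zonal p) (p^`().[x 0 0] * v 0 0).
Proof. apply: is_derive_horner; exact: is_derive_coord. Qed.

Lemma pderiv_zonal (i : 'I_5) p : pderiv i (zonal p) =
  if i == 0 then zonal p^`() else zonal 0.
Proof.
apply/funext => x; rewrite /pderiv (@derive_val _ _ _ _ _ _ _ (is_derive_zonal p x _)) mxE eqxx/=.
by rewrite eq_sym; case: eqP => _; rewrite /zonal ?hornerE ?mulr1 ?mulr0.
Qed.

Lemma smooth_zonal p : smooth (zonal p).
Proof.
have cont q : continuous (zonal q).
  move=> x; apply: (@continuous_comp _ _ _ (fun y : 'rV[R]_5 => y 0 0) (horner q)).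
    exact: coord_continuous.
  exact: continuous_horner.
move=> k; elim: k p => [|k IH] p; split => //.
move=> i; split; first by move=> x; case: (is_derive_zonal p x (delta_mx 0 i)).
by rewrite pderiv_zonal; case: ifP.
Qed.


Definition zonal_laplace (p : {poly R}) : {poly R} :=
  (1 - 'X^2) * p^`()^`() - 4%:R *: ('X * p^`()).
Definition zonal_paneitz p : {poly R} := zonal_laplace (zonal_laplace p) - 2%:R *: zonal_laplace p.
Definition zonal_remainder (p : {poly R}) : {poly R} := 2%:R *: ('X * p^`()) + 'X^2 * p^`()^`().

Definition sqnorm (x : 'rV[R]_5) := \sum_(i < 5) x 0 i ^+ 2.

Lemma is_derive_sqnorm (x v : 'rV[R]_5) :
  is_derive x v sqnorm (\sum_(i < 5) 2 * x 0 i * v 0 i).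
Proof.
rewrite (_ : sqnorm = \sum_(i < 5) (fun y : 'rV[R]_5 => y 0 i) ^+ 2); last first.
  by apply/funext => y; rewrite /sqnorm fct_sumE.
have H i : is_derive x v ((fun y : 'rV[R]_5 => y 0 i) ^+ 2) (2 * x 0 i * v 0 i).
  apply: (is_derive_eq (is_deriveX 2 (is_derive_coord i x v))).
  by rewrite expr1 /GRing.scale /=; ring.
exact: is_derive_sum.
Qed.

Lemma is_derive_sqnorm_delta (x : 'rV[R]_5) j :
  is_derive x (delta_mx 0 j) sqnorm (2 * x 0 j).
Proof.
apply: (is_derive_eq (is_derive_sqnorm x (delta_mx 0 j))); rewrite (bigD1 j)//= big1 => [|i ij].
  by rewrite mxE !eqxx mulr1 addr0.
by rewrite mxE eqxx (negbTE ij) mulr0.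
Qed.

Lemma pderivE i (f : 'rV[R]_5 -> R) x df :
  is_derive x (delta_mx 0 i) f df -> pderiv i f x = df.
Proof. by move=> H; rewrite /pderiv derive_val. Qed.

Lemma sum5_delta (F : 'I_5 -> R) (i : 'I_5) :
  \sum_(j < 5) F j * (j == i)%:R = F i.
Proof.
rewrite (bigD1 i)//= big1 => [|j ji]; first by rewrite eqxx mulr1 addr0.
by rewrite (negbTE ji) mulr0.
Qed.

Lemma tderiv_zonal p i x :
  tderiv i (zonal p) x = p^`().[x 0 0] * ((i == 0)%:R - x 0 i * x 0 0).
Proof.
have E j : pderiv j (zonal p) x = p^`().[x 0 0] * (j == 0)%:R.
  by rewrite (pderivE (is_derive_zonal p x _)) mxE eqxx /= eq_sym.
rewrite /tderiv E; under eq_bigr do rewrite E mulrA.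
by rewrite sum5_delta; ring.
Qed.

(** The formulas behind [laplace_beltrami] are intrinsic on the unit sphere only. Off the sphere a
    multiple of [sqnorm x - 1] appears, and it has to be recorded because the second application in
    [paneitz] differentiates in R^5. *)
Lemma laplace_zonal p x : laplace_beltrami (zonal p) x =
  (zonal_laplace p).[x 0 0] + (sqnorm x - 1) * (zonal_remainder p).[x 0 0].
Proof.
rewrite /laplace_beltrami.
have T i : tderiv i (tderiv i (zonal p)) x =
  p^`()^`().[x 0 0] * ((i == 0)%:R - x 0 i * x 0 0) ^+ 2 +
  p^`().[x 0 0] * (- x 0 0 - x 0 i * (i == 0)%:R + 2 * x 0 0 * x 0 i ^+ 2).
  rewrite (_ : tderiv i (zonal p) =
    zonal p^`() * (cst (i == 0)%:R - (fun y : 'rV[R]_5 => y 0 i) * (fun y => y 0 0))); last first.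
    by apply/funext => y; rewrite tderiv_zonal.
  have E j : pderiv j (zonal p^`() *
        (cst (i == 0)%:R - (fun y : 'rV[R]_5 => y 0 i) * (fun y => y 0 0))) x
    = (p^`()^`().[x 0 0] * ((i == 0)%:R - x 0 i * x 0 0) - p^`().[x 0 0] * x 0 i)
        * (j == 0)%:R
      - p^`().[x 0 0] * x 0 0 * (j == i)%:R.
    apply: pderivE.
    have H1 := is_derive_coord i x (delta_mx 0 j).
    have H2 := is_derive_coord 0 x (delta_mx 0 j).
    have H3 := is_derive_zonal p^`() x (delta_mx 0 j).
    apply: (is_derive_eq (is_deriveM H3 (is_deriveB (is_derive_cst _ _ _) (is_deriveM H1 H2)))).
    rewrite /GRing.scale /= !mxE !eqxx /= (eq_sym i j) (eq_sym 0 j) /zonal /cst.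
    by rewrite [X in _ + X * _](_ : _ = (i == 0)%:R - x 0 i * x 0 0) //; ring.
  rewrite /tderiv E; under eq_bigr do rewrite E mulrBr !mulrA.
  rewrite sumrB !sum5_delta eqxx (eq_sym i 0).
  by rewrite (_ : true%:R = 1 :> R) //; ring.
under eq_bigr do rewrite T.
rewrite /sqnorm /zonal_laplace /zonal_remainder !hornerE !big_ord_recl !big_ord0.
have -> : ord0 = 0 :> 'I_5 by [].
by rewrite eqxx /=; ring.
Qed.

(** The Euclidean gradient of a function that vanishes on the sphere is normal there, so its
    tangential part is 0. *)
Lemma tderiv_sqnorm_mul (i : 'I_5) (g : 'rV[R]_5 -> R) x :
  (forall j, derivable g x (delta_mx 0 j)) -> sqnorm x = 1 ->
  tderiv i ((sqnorm - cst 1) * g) x = 0.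
Proof.
move=> dg x1; have E j : pderiv j ((sqnorm - cst 1) * g) x = 2 * x 0 j * g x.
  have /derivableP H := dg j.
  apply: pderivE; apply: (is_derive_eq (is_deriveM
    (is_deriveB (is_derive_sqnorm_delta x j) (is_derive_cst _ _ _)) H)).
  by rewrite /GRing.scale /= (_ : (sqnorm - cst 1) x = sqnorm x - 1) // x1; ring.
rewrite /tderiv; under eq_bigr do rewrite E.
have -> : \sum_(j < 5) x 0 j * (2 * x 0 j * g x) = 2 * g x * sqnorm x.
  by rewrite /sqnorm mulr_sumr; apply: eq_bigr => j _; ring.
by rewrite E x1; ring.
Qed.

Lemma tderivD (i : 'I_5) (f g : 'rV[R]_5 -> R) x :
  (forall j, derivable f x (delta_mx 0 j)) ->
  (forall j, derivable g x (delta_mx 0 j)) ->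
  tderiv i (f + g) x = tderiv i f x + tderiv i g x.
Proof.
move=> df dg; have E j : pderiv j (f + g) x = pderiv j f x + pderiv j g x.
  by rewrite /pderiv deriveD.
rewrite /tderiv E; under eq_bigr do rewrite E mulrDr.
by rewrite big_split /=; ring.
Qed.

(** The remainder of [laplace_zonal] disappears on the sphere: one tangential derivative of
    [(sqnorm - cst 1) * zonal q] is again a multiple [(sqnorm - cst 1) * g i], valid on all of R^5,
    and the next one vanishes where [sqnorm x = 1]. *)
Lemma laplace2_zonal p x : sqnorm x = 1 ->
  laplace_beltrami (laplace_beltrami (zonal p)) x = (zonal_laplace (zonal_laplace p)).[x 0 0].
Proof.
move=> x1.
have -> : laplace_beltrami (zonal p) = zonal (zonal_laplace p) + (sqnorm - cst 1) * zonal (zonal_remainder p).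
  by apply/funext => y; rewrite laplace_zonal.
have dax q y j : derivable (zonal q) y (delta_mx 0 j).
  by case: (is_derive_zonal q y (delta_mx 0 j)).
have dsq y j : derivable (sqnorm - cst 1) y (delta_mx 0 j).
  by apply: derivableB => //; case: (is_derive_sqnorm_delta y j).
set q := zonal_remainder p.
pose g i : 'rV[R]_5 -> R := fun y =>
  q^`().[y 0 0] * ((i == 0)%:R - y 0 i * y 0 0) - 2 * y 0 i * q.[y 0 0].
have T i : tderiv i (zonal (zonal_laplace p) + (sqnorm - cst 1) * zonal q) =
  tderiv i (zonal (zonal_laplace p)) + (sqnorm - cst 1) * g i.
  apply/funext => y; rewrite tderivD //; last by move=> j; exact: derivableM.
  congr (_ + _).
  have E j : pderiv j ((sqnorm - cst 1) * zonal q) y =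
      2 * y 0 j * q.[y 0 0] + (sqnorm y - 1) * q^`().[y 0 0] * (j == 0)%:R.
    apply: pderivE; apply: (is_derive_eq (is_deriveM
      (is_deriveB (is_derive_sqnorm_delta y j) (is_derive_cst _ _ _))
      (is_derive_zonal q y _))).
    rewrite /GRing.scale /= !mxE eqxx /= (eq_sym 0 j) /zonal.
    by rewrite (_ : (sqnorm - cst 1) y = sqnorm y - 1) //; ring.
  rewrite /tderiv E; under eq_bigr do rewrite E mulrDr !mulrA.
  rewrite big_split /= sum5_delta.
  have -> : \sum_(j < 5) y 0 j * 2 * y 0 j * q.[y 0 0] = 2 * q.[y 0 0] * sqnorm y.
    by rewrite /sqnorm mulr_sumr; apply: eq_bigr => j _; ring.
  by rewrite [RHS](_ : _ = (sqnorm y - 1) * g i y) // /g /=; ring.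
have -> : (zonal_laplace (zonal_laplace p)).[x 0 0] = laplace_beltrami (zonal (zonal_laplace p)) x.
  by rewrite laplace_zonal x1 subrr mul0r addr0.
rewrite /laplace_beltrami; apply: eq_bigr => i _.
rewrite T; have dg j : derivable (g i) x (delta_mx 0 j).
  have H (k : 'I_5) := is_derive_coord k x (delta_mx 0 j).
  case: (is_deriveB (is_deriveM (is_derive_zonal q^`() x (delta_mx 0 j))
    (is_deriveB (is_derive_cst ((i == 0)%:R : R^o) _ _) (is_deriveM (H i) (H 0))))
    (is_deriveM (is_deriveZ 2 (H i)) (is_derive_zonal q x (delta_mx 0 j)))) => K _.
  exact: K.
rewrite tderivD; [|move=> j|by move=> j; exact: derivableM].
  by rewrite tderiv_sqnorm_mul // addr0.
rewrite (_ : tderiv i (zonal (zonal_laplace p)) =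
    zonal (zonal_laplace p)^`() * (cst (i == 0)%:R - (fun y : 'rV[R]_5 => y 0 i) * (fun y => y 0 0))); last first.
  by apply/funext => y; rewrite tderiv_zonal.
have H (k : 'I_5) := is_derive_coord k x (delta_mx 0 j).
by case: (is_deriveM (is_derive_zonal (zonal_laplace p)^`() x (delta_mx 0 j))
    (is_deriveB (is_derive_cst ((i == 0)%:R : R^o) _ _) (is_deriveM (H i) (H 0)))).
Qed.

Lemma paneitz_zonal p x : sqnorm x = 1 -> paneitz (zonal p) x = (zonal_paneitz p).[x 0 0].
Proof.
move=> x1; rewrite /paneitz laplace2_zonal // laplace_zonal x1 subrr mul0r addr0.
by rewrite /zonal_paneitz !hornerE.
Qed.

Lemma sqnorm_polar t : sqnorm (polar t) = 1.
Proof.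
case: t => [[[t1 t2] t3] t4]; rewrite /sqnorm !big_ord_recl big_ord0 !mxE /=.
have E (t : R) : sin t ^+ 2 = 1 - cos t ^+ 2 by rewrite -(cos2Dsin2 t); ring.
by rewrite !exprMn !E; ring.
Qed.

Lemma polar0 t : (polar t : 'rV[R]_5) 0 0 = cos t.1.1.1.
Proof. by case: t => [[[t1 t2] t3] t4]; rewrite mxE. Qed.

End calculus.

(** * Integrability and moments *)

Section moments.
Context {R : realType}.
Notation mu := (@lebesgue_measure R).

Lemma integrable_mulr_bounded d (T : measurableType d) (m : {measure set T -> \bar R})
    (D : set T) (h k : T -> R) (M : R) : measurable D ->
  m.-integrable D (EFin \o h) -> measurable_fun D k ->
  (forall x, D x -> `|k x| <= M) ->
  m.-integrable D (EFin \o (fun x => h x * k x)).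
Proof.
move=> mD ih mk kM.
apply: (@le_integrable _ _ _ _ _ mD _ (fun x => M%:E * (EFin \o h) x)%E).
- have /measurable_EFinP mh := measurable_int _ ih.
  by apply/measurable_EFinP; exact: measurable_funM.
- move=> x Dx; have kx := kM _ Dx; rewrite /= lee_fin !normrM mulrC.
  by rewrite ler_wpM2r// (le_trans kx)// ler_norm.
- exact: integrableZl.
Qed.

Lemma integrable_subr d (T : measurableType d) (m : {measure set T -> \bar R})
    (D : set T) (f g : T -> R) : measurable D ->
  m.-integrable D (EFin \o f) -> m.-integrable D (EFin \o g) ->
  m.-integrable D (EFin \o (fun x => f x - g x)).
Proof. by move=> mD fi gi; exact: (integrableB mD fi gi). Qed.

Lemma integrable_scaler d (T : measurableType d) (m : {measure set T -> \bar R})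
    (D : set T) (f : T -> R) (c : R) : measurable D ->
  m.-integrable D (EFin \o f) -> m.-integrable D (EFin \o (fun x => c * f x)).
Proof. by move=> mD fi; exact: (integrableZl mD c fi). Qed.

Lemma integrable_addr d (T : measurableType d) (m : {measure set T -> \bar R})
    (D : set T) (f g : T -> R) : measurable D ->
  m.-integrable D (EFin \o f) -> m.-integrable D (EFin \o g) ->
  m.-integrable D (EFin \o (fun x => f x + g x)).
Proof. by move=> mD fi gi; exact: (integrableD mD fi gi). Qed.

Lemma bernoulli_ge (t : R) n : 0 <= t <= 1 -> 1 - n%:R * t <= (1 - t) ^+ n.
Proof.
move=> /andP[t0 t1]; elim: n => [|n IH]; first by rewrite expr0; lra.
have n0 : 0 <= n%:R :> R by [].
rewrite exprS (le_trans _ (ler_wpM2l _ IH))//; last lra.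
by rewrite -natr1; nra.
Qed.

(** n t <= 1 + n t <= (1 + t)^n, and (1 + t)^n (1 - t)^n = (1 - t^2)^n <= 1. *)
Lemma bernoulli_le (t : R) n : 0 <= t <= 1 -> n%:R * t * (1 - t) ^+ n <= 1.
Proof.
move=> /andP[t0 t1]; have h : 1 + n%:R * t <= (1 + t) ^+ n.
  elim: n => [|n IH]; first by rewrite expr0; lra.
  have n0 : 0 <= n%:R :> R by [].
  rewrite exprS; apply: le_trans (ler_wpM2l _ IH); last lra.
  by rewrite -natr1; nra.
have e0 : 0 <= (1 - t) ^+ n by apply: exprn_ge0; lra.
apply: (@le_trans _ _ ((1 + t) ^+ n * (1 - t) ^+ n)).
  by apply: ler_wpM2r => //; lra.
rewrite -exprMn exprn_ile1//; nra.
Qed.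

(* On [0, 1] these polynomials converge to the indicator function of [0, 1/2[
   off 1/2. *)
Definition bump (n : nat) (y : R) := (1 - y ^+ n) ^+ (2 ^ n).

Lemma bump_itv n y : 0 <= y <= 1 -> 0 <= bump n y <= 1.
Proof.
move=> /andP[y0 y1]; have yn0 : 0 <= y ^+ n by exact: exprn_ge0.
have yn1 : y ^+ n <= 1 by exact: exprn_ile1.
by rewrite /bump; apply/andP; split; [apply: exprn_ge0|apply: exprn_ile1]; lra.
Qed.

(** The exponent [2 ^ n] turns the two Bernoulli bounds at [y ^ n] into powers of [2 * y]: the lower
    bound 1 - (2 y)^n here, the upper bound (2 y)^-n in [bump_cvg0]. *)
Lemma bump_cvg1 y : 0 <= y < 2^-1 -> bump n y @[n --> \oo] --> (1 : R).
Proof.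
move=> /andP[y0 y1].
apply: (@squeeze_cvgr _ _ _ _ (fun n => 1 - (2 * y) ^+ n) (cst 1)).
- apply: nearW => n; rewrite (andP (bump_itv n _)).2 ?andbT; last lra.
  have yn0 : 0 <= y ^+ n by exact: exprn_ge0.
  have yn1 : y ^+ n <= 1 by apply: exprn_ile1 => //; lra.
  apply: le_trans (bernoulli_ge _ _); last by rewrite yn0.
  by rewrite exprMn natrX.
- rewrite -[X in _ --> X]subr0; apply: cvgB; first exact: cvg_cst.
  by apply: cvg_expr; rewrite ger0_norm; lra.
- exact: cvg_cst.
Qed.

Lemma bump_cvg0 y : 2^-1 < y <= 1 -> bump n y @[n --> \oo] --> (0 : R).
Proof.
move=> /andP[y0 y1]; have ypos : 0 < y by lra.
apply: (@squeeze_cvgr _ _ _ _ (cst 0) (fun n => (2 * y)^-1 ^+ n)).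
- apply: nearW => n; rewrite (andP (bump_itv n _)).1 /=; last lra.
  have yn0 : 0 < y ^+ n by exact: exprn_gt0.
  have yn1 : y ^+ n <= 1 by apply: exprn_ile1; lra.
  have e0 : 0 < (2 * y) ^+ n by apply: exprn_gt0; lra.
  rewrite exprVn -[leRHS]mul1r ler_pdivlMr//.
  have := @bernoulli_le (y ^+ n) (2 ^ n); rewrite natrX -exprMn mulrC; apply.
  by rewrite (ltW yn0).
- exact: cvg_cst.
- apply: cvg_expr; rewrite ger0_norm ?invr_ge0; last lra.
  by rewrite invf_lt1; lra.
Qed.

Lemma continuous_horner_cos (p : {poly R}) : continuous (fun t : R => p.[cos t]).
Proof.
move=> t; apply: (@continuous_comp _ _ _ cos (horner p)).
  exact: continuous_cos.
exact: continuous_horner.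
Qed.

Lemma measurable_horner_cos (D : set R) (p : {poly R}) :
  measurable_fun D (fun t : R => p.[cos t]).
Proof.
apply: measurable_funTS; apply: continuous_measurable_fun.
exact: continuous_horner_cos.
Qed.

Lemma horner_cos_bounded (p : {poly R}) : exists M, forall t, `|p.[cos t]| <= M.
Proof.
elim/poly_ind: p => [|p c [M HM]].
  by exists 0 => t; rewrite horner0 normr0.
exists (M + `|c|) => t; rewrite hornerMXaddC.
apply: le_trans (ler_normD _ _) _; rewrite lerD2r normrM (le_trans _ (HM t))//.
rewrite ler_piMr// ler_norml; apply/andP.
by have := cos_le1 t; have := cos_geN1 t; split; lra.
Qed.

Lemma integrable_mulr_horner_cos (D : set R) (h : R -> R) (p : {poly R}) :
  measurable D -> mu.-integrable D (EFin \o h) ->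
  mu.-integrable D (EFin \o (fun t => h t * p.[cos t])).
Proof.
move=> mD ih; have [M HM] := horner_cos_bounded p.
apply: (@integrable_mulr_bounded _ _ _ _ _ _ M) => //.
exact: measurable_horner_cos.
Qed.

(** The indicator of an initial segment is an almost everywhere limit of polynomials in cos t with
    values in [0, 1], so dominated convergence, with bound |h|, passes the vanishing moments to
    it. *)
Lemma moments_cos_initial (h : R -> R) (a : R) :
  mu.-integrable `[0, pi] (EFin \o h) ->
  (forall p : {poly R}, \int[mu]_(t in `[0, pi]) (h t * p.[cos t]) = 0) ->
  0 < a < pi ->
  \int[mu]_(t in `[0, pi]) (h t * \1_(`]-oo, a]) t) = 0.
Proof.
move=> ih h0 /andP[a0 api].
(* On [0, pi] this decreases and takes the value 1/2 exactly at [a], the threshold of [bump]; the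
   divisor 4 keeps it in [0, 1]. *)
pose y (t : R) := 2^-1 + (cos t - cos a) / 4.
have [P yE] : exists P : {poly R}, forall t, P.[cos t] = y t.
  exists ((2^-1 - cos a / 4)%:P + 4^-1 *: 'X) => t.
  by rewrite !hornerE /y; lra.
pose q n : {poly R} := 1 - (1 - P ^+ n) ^+ (2 ^ n).
have qE n t : (q n).[cos t] = 1 - bump n (y t).
  by rewrite /q /bump !(hornerE, horner_exp) yE.
have yitv t : 0 <= y t <= 1.
  have := cos_le1 t; have := cos_le1 a; have := cos_geN1 t; have := cos_geN1 a.
  by rewrite /y => *; lra.
pose f_ n t : \bar R := (h t * (q n).[cos t])%:E.
have mI : measurable (`[0%R, pi]%classic : set R) by [].
have /measurable_EFinP mh := measurable_int _ ih.
have [] := @dominated_convergence _ _ _ mu `[0, pi] mI f_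
   (fun t => (h t * \1_(`]-oo, a]) t)%:E) (abse \o (EFin \o h)).
- move=> n; apply/measurable_EFinP; apply: measurable_funM => //.
  exact: measurable_horner_cos.
- apply/measurable_EFinP; apply: measurable_funM => //.
- exists [set a]; split => //; first exact: lebesgue_measure_set1.
  move=> t /= H; apply: contrapT => /eqP ta; apply: H => t0pi.
  apply: cvg_EFin; first exact: nearW.
  rewrite (_ : _ \o _ = (fun n => h t * (1 - bump n (y t)))); last first.
    by apply/funext => n; rewrite /f_ /= qE.
  apply: cvgM; first exact: cvg_cst.
  have a_in : a \in `[0%R, pi] by rewrite in_itv/= !ltW.
  rewrite indicE; have [ta'|ta'] := boolP (t \in _).
    rewrite -[X in _ --> X]subr0; apply: cvgB; first exact: cvg_cst.
    apply: bump_cvg0; rewrite (andP (yitv t)).2 andbT /y.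
    have : cos a < cos t.
      rewrite ltr_cos// lt_neqAle ta /=.
      by move: ta'; rewrite inE/= in_itv.
    lra.
  rewrite -[X in _ --> X](subrr 1); apply: cvgB; first exact: cvg_cst.
  apply: bump_cvg1; rewrite (andP (yitv t)).1 /= /y.
  have : cos t < cos a.
    rewrite ltr_cos//; move: ta'; rewrite notin_setE /= in_itv /= => /negP.
    by rewrite -ltNge.
  lra.
- exact: integrable_abse.
- apply: aeW => t n _ /=; rewrite lee_fin normrM ler_piMr// qE.
  by have := bump_itv n (yitv t) => /andP[? ?]; rewrite ger0_norm; lra.
move=> _ _; rewrite (_ : [sequence _]_n = cst 0%E); last first.
  apply/funext => n /=; have := h0 (q n); rewrite /Rintegral => /eqP.
  rewrite fine_eq0 => [/eqP//|].
  apply: integrable_fin_num => //.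
  apply: (@integrable_mulr_bounded _ _ _ _ _ _ 1) => //.
    exact: measurable_horner_cos.
  move=> t _; rewrite qE.
  by have := bump_itv n (yitv t) => /andP[? ?]; rewrite ger0_norm; lra.
by move=> H; rewrite /Rintegral -(cvg_lim _ H)// lim_cst.
Qed.

(** By Lebesgue differentiation [h] is almost everywhere the derivative of its primitive, which
    vanishes identically on ]0, b[. *)
Lemma integrable_eq0_ae (h : R -> R) (b : R) :
  mu.-integrable `[0, b] (EFin \o h) ->
  (forall a, 0 < a < b -> \int[mu]_(t in `[0, b]) (h t * \1_(`]-oo, a]) t) = 0) ->
  {ae mu, forall t, 0 < t < b -> h t = 0}.
Proof.
move=> ih h0.
have iH : mu.-integrable setT (EFin \o (h \_ `[0, b])).
  by rewrite -restrict_EFin; apply/(integrable_mkcond _ _).1.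
have loc : locally_integrable setT (h \_ `[0, b]) by exact: integrable_locally.
have /FTC1Ny/(_ loc) : forall y, mu.-integrable `]-oo, y] (EFin \o (h \_ `[0, b])).
  by move=> y; apply: integrableS iH.
apply: filterS; first exact: (ae_filter_ringOfSetsType mu).
move=> x [_ E] /andP[x0 xb].
rewrite -[LHS](_ : (h \_ `[0, b]) x = _); last first.
  by rewrite patchE mem_set//= in_itv/= !ltW.
rewrite -E derive1E; rewrite -(near_eq_derive _ _ (f := cst 0)) ?derive_cst//.
near=> y.
have y0b : 0 < y < b.
  by apply/andP; split; near: y; [exact: lt_nbhsr|exact: lt_nbhsl].
rewrite /cst -[LHS](h0 _ y0b).
rewrite Rintegral_mkcond [RHS]Rintegral_mkcond; apply: eq_Rintegral => t _.
rewrite !patchE indicE; case: ifPn => /= _; case: ifPn => //= _.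
  by rewrite mulr1.
by rewrite mulr0.
Unshelve. all: end_near. Qed.

Lemma moments_cos_eq0 (h : R -> R) : mu.-integrable `[0, pi] (EFin \o h) ->
  (forall p : {poly R}, \int[mu]_(t in `[0, pi]) (h t * p.[cos t]) = 0) ->
  {ae mu, forall t, 0 < t < pi -> h t = 0}.
Proof.
by move=> ih h0; apply: integrable_eq0_ae => // a; exact: moments_cos_initial.
Qed.

End moments.

(** * Real calculus *)

Section real_calculus.
Context {R : realType}.
Notation mu := (@lebesgue_measure R).
Implicit Types (x : R) (f g : R -> R).

(** The rules from here on are stated for explicit functions of [t] and real values, so that a
    derivative is assembled as one term and [der_eq] leaves a single algebraic identity. *)
Lemma der_eq x f (a b : R) : is_derive x 1 f a -> a = b -> is_derive x 1 f b.
Proof. by move=> + <-. Qed.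

Lemma derD x f g (a b : R) : is_derive x 1 f a -> is_derive x 1 g b ->
  is_derive x 1 (fun t => f t + g t) (a + b).
Proof. by move=> Hf Hg; exact: is_deriveD. Qed.

Lemma derN x f (a : R) : is_derive x 1 f a -> is_derive x 1 (fun t => - f t) (- a).
Proof. by move=> Hf; exact: is_deriveN. Qed.

Lemma derB x f g (a b : R) : is_derive x 1 f a -> is_derive x 1 g b ->
  is_derive x 1 (fun t => f t - g t) (a - b).
Proof. by move=> Hf Hg; exact: is_deriveB. Qed.

Lemma derM x f g (a b : R) : is_derive x 1 f a -> is_derive x 1 g b ->
  is_derive x 1 (fun t => f t * g t) (a * g x + f x * b).
Proof.
move=> Hf Hg; apply: der_eq (is_deriveM Hf Hg) _.
by rewrite /GRing.scale /=; ring.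
Qed.

Lemma derV x f (a : R) : f x != 0 -> is_derive x 1 f a ->
  is_derive x 1 (fun t => (f t)^-1) (- a / f x ^+ 2).
Proof.
move=> fx0 Hf; apply: der_eq (is_deriveV fx0 Hf) _.
by rewrite /GRing.scale /= mulrC mulrN mulNr.
Qed.

Lemma derX x f (a : R) n : is_derive x 1 f a ->
  is_derive x 1 (fun t => f t ^+ n) (n%:R * f x ^+ n.-1 * a).
Proof.
move=> Hf; rewrite (_ : (fun _ => _) = f ^+ n); first exact: is_deriveX.
by apply/funext => t; rewrite fctE.
Qed.

Lemma der_cst (x c : R) : is_derive x 1 (fun=> c : R) 0.
Proof. exact: is_derive_cst. Qed.

Lemma der_comp x f g (a b : R) : is_derive (g x) 1 f a -> is_derive x 1 g b ->
  is_derive x 1 (fun t => f (g t)) (a * b).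
Proof. by move=> *; exact: is_derive1_comp. Qed.

Lemma der_refl x c f (a : R) : is_derive (c - x) 1 f a ->
  is_derive x 1 (fun t => f (c - t)) (- a).
Proof.
move=> H; apply: der_eq (der_comp (g := fun t => c - t) H
  (derB (der_cst _ _) (is_derive_id _ _))) _.
by rewrite sub0r mulrN1.
Qed.

Lemma der_horner_cos x (p : {poly R}) :
  is_derive x 1 (fun t => p.[cos t]) (- sin x * p^`().[cos x]).
Proof.
apply: der_eq (is_derive_horner p (is_derive_cos x)) _; ring.
Qed.

Lemma der_continuous x f (a : R) : is_derive x 1 f a -> {for x, continuous f}.
Proof. by case=> H _; apply/differentiable_continuous/derivable1_diffP. Qed.

Lemma der_mono (a b : R) f df :
  (forall x, a < x < b -> is_derive x 1 f (df x)) ->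
  (forall x, a < x < b -> 0 <= df x) ->
  forall x y, a < x -> x <= y -> y < b -> f x <= f y.
Proof.
move=> Hf df0 x y ax xy yb.
apply: (@ger0_derive1_le_oo _ f a b) => //.
- by move=> z; rewrite in_itv/= => /Hf[].
- move=> z; rewrite in_itv/= => zab; rewrite derive1E.
  by case: (Hf _ zab) => _ ->; exact: df0.
- by move=> z; rewrite inE /= in_itv/= => /Hf /der_continuous.
- by rewrite in_itv/= ax (le_lt_trans xy).
- by rewrite in_itv/= yb (lt_le_trans ax).
Qed.

Lemma der_dominated (a b : R) f df g dg :
  (forall x, a < x < b -> is_derive x 1 f (df x)) ->
  (forall x, a < x < b -> is_derive x 1 g (dg x)) ->
  (forall x, a < x < b -> `|df x| <= dg x) ->
  forall x y, a < x -> x <= y -> y < b -> `|f y - f x| <= g y - g x.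
Proof.
move=> Hf Hg H x y ax xy yb.
have P1 := der_mono (fun z zab => derB (Hg z zab) (Hf z zab)) _ ax xy yb.
have P2 := der_mono (fun z zab => derD (Hg z zab) (Hf z zab)) _ ax xy yb.
have {}P1 : g x - f x <= g y - f y.
  by apply: P1 => z zab; have := H z zab; rewrite ler_norml => /andP[]; lra.
have {}P2 : g x + f x <= g y + f y.
  by apply: P2 => z zab; have := H z zab; rewrite ler_norml => /andP[]; lra.
by rewrite ler_norml; apply/andP; split; lra.
Qed.

Lemma der0_cst (a b : R) f : (forall x, a < x < b -> is_derive x 1 f 0) ->
  forall x y, a < x < b -> a < y < b -> f x = f y.
Proof.
move=> Hf; have E x y : a < x -> x <= y -> y < b -> f x = f y.
  move=> ax xy yb; apply/eqP.
  have H0 z : a < z < b -> `|0 : R| <= 0 by rewrite normr0.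
  have := der_dominated Hf (fun z _ => der_cst z 0) H0 ax xy yb.
  by rewrite subrr normr_le0 subr_eq0 eq_sym.
move=> x y /andP[ax xb] /andP[ay yb].
by have [xy|/ltW yx] := leP x y; [|apply/esym]; apply: E.
Qed.

Lemma antiderivative_co (a b : R) f :
  (forall x, a <= x < b -> {for x, continuous f}) ->
  exists G, forall x, a < x < b -> is_derive x 1 G (f x).
Proof.
move=> cf; exists (fun x => \int[mu]_(t in `[a, x]) f t) => x /andP[ax xb].
(* [f] may be singular at [b], so the closed interval for the fundamental theorem stops between [x]
   and [b]. *)
have xu : x < (x + b) / 2 by lra.
have cx : {for x, continuous f} by apply: cf; rewrite (ltW ax).
have ci : mu.-integrable `[a, (x + b) / 2] (EFin \o f).
  apply: continuous_compact_integrable; first exact: segment_compact.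
  apply: continuous_in_subspaceT => z; rewrite inE /= in_itv /= => /andP[az zu].
  by apply: cf; rewrite az/=; lra.
have [Gd Ge] := continuous_FTC1_closed xu ci ax cx.
by split; rewrite -?derive1E.
Qed.

Lemma antiderivative_oo (a b : R) f : a < b ->
  (forall x, a < x < b -> {for x, continuous f}) ->
  exists G, forall x, a < x < b -> is_derive x 1 G (f x).
Proof.
move=> ab cf; pose c := (a + b) / 2.
have [|G1 H1] := @antiderivative_co a b (fun x => f (Num.max x c)).
  move=> x /andP[ax xb]; apply: (@continuous_comp _ _ _ (fun x => Num.max x c) f).
    by apply: continuous_max; [exact: cvg_id|exact: cvg_cst].
  apply: cf; rewrite lt_max gt_max; apply/andP; split; last by apply/andP; split => //; rewrite /c; lra.
  by apply/orP; right; rewrite /c; lra.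
have [|G2 H2] := @antiderivative_co (- b) (- a) (fun x => f (Num.min (- x) c)).
  move=> x /andP[ax xb]; apply: (@continuous_comp _ _ _ (fun x => Num.min (- x) c) f).
    by apply: continuous_min; [exact: continuousN|exact: cvg_cst].
  apply: cf; rewrite lt_min gt_min; apply/andP; split.
    by apply/andP; split; rewrite /c; lra.
  by apply/orP; right; rewrite /c; lra.
(* One of [Num.max x c] and [Num.min x c] is [x] and the other is [c], so f (max x c) + f (min x c)
   - f c = f x. *)
exists (fun x => G1 x - G2 (- x) - f c * x) => x /andP[ax xb].
have D2 : is_derive x 1 (fun t => G2 (- t)) (- f (Num.min x c)).
  rewrite (_ : (fun _ => _) = (fun t => G2 (0 - t))); last first.
    by apply/funext => t; rewrite sub0r.
  apply: der_refl; rewrite sub0r -{2}[x]opprK; apply: H2.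
  by apply/andP; split; lra.
have D1 := H1 x; rewrite ax xb in D1.
apply: der_eq (derB (derB (D1 isT) D2) (derM (der_cst _ _) (is_derive_id _ _))) _.
by have [xc|xc] := leP x c; lra.
Qed.

Lemma cvg_at_left_refl (c : R) f (l : R) :
  f (c - x) @[x --> 0^'+] --> l -> f x @[x --> c^'-] --> l.
Proof.
move=> /cvgrPdist_lt H; apply/cvgrPdist_lt => e e0.
have [d /= d0 Hd] := H e e0.
exists d => //= y; rewrite /= => cyd yc.
have := Hd (c - y); rewrite /= sub0r normrN subKr; apply => //.
by rewrite subr_gt0.
Qed.

End real_calculus.

(** * Behaviour at the poles *)

Section poles.
Context {R : realType}.
Implicit Types (x : R) (f g N A B F W G : R -> R).

Lemma sin_gt0 x : 0 < x < pi -> 0 < sin x.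
Proof. by move=> H; exact: sin_gt0_pi. Qed.

Lemma cos_lt1_oo x : 0 < x < 2 * pi -> cos x < 1.
Proof.
move=> /andP[x0 xp].
have h : 0 < sin (x / 2) by apply: sin_gt0; apply/andP; split; lra.
have := cosD (x / 2) (x / 2); have := cos2Dsin2 (x / 2).
have -> : x / 2 + x / 2 = x by lra.
by move=> h1 ->; nra.
Qed.

Lemma cos_gtN1_oo x : - pi < x < pi -> -1 < cos x.
Proof.
move=> /andP[x0 xp]; have := @cos_lt1_oo (pi - x); rewrite cosB cospi sinpi.
move=> H; suff: -1 * cos x + 0 * sin x < 1 by lra.
by apply: H; apply/andP; split; lra.
Qed.

Lemma sin2E x : sin x ^+ 2 = (1 - cos x) * (1 + cos x).
Proof.
have -> : sin x ^+ 2 = 1 - cos x ^+ 2 by rewrite -(cos2Dsin2 x); ring.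
by ring.
Qed.

Lemma cvg_cos0 : cos x @[x --> 0^'+] --> (1 : R).
Proof.
apply: cvg_at_right_filter; rewrite -[X in _ --> X]cos0.
exact: continuous_cos.
Qed.

Lemma cvg_sin0 : sin x @[x --> 0^'+] --> (0 : R).
Proof.
apply: cvg_at_right_filter; rewrite -[X in _ --> X]sin0.
exact: continuous_sin.
Qed.

Lemma near0_pi : \forall x \near (0 : R)^'+, 0 < x < pi.
Proof.
near=> x; apply/andP; split; near: x; first exact: nbhs_right_gt.
by apply: nbhs_right_lt; exact: pi_gt0.
Unshelve. all: by end_near. Qed.

Lemma cvg0_near (f : R -> R) (e : R) : f x @[x --> 0^'+] --> (0 : R) -> 0 < e ->
  exists2 d, 0 < d < pi & forall x, 0 < x < d -> `|f x| < e.
Proof.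
move=> /cvgrPdist_lt H e0; have [d /= d0 Hd] := H e e0.
exists (Num.min d pi / 2).
  have dp : 0 < Num.min d pi <= pi by rewrite lt_min d0 pi_gt0 ge_min lexx orbT.
  by apply/andP; split; lra.
move=> x /andP[x0 xd]; have := Hd x; rewrite /= !sub0r !normrN; apply => //.
rewrite gtr0_norm//; have : Num.min d pi <= d by rewrite ge_min lexx.
by lra.
Qed.

Lemma der_1Bcos x : is_derive x 1 (fun t => 1 - cos t) (sin x).
Proof. by apply: der_eq (derB (der_cst _ _) (is_derive_cos x)) _; lra. Qed.

(** Near 0 one has |N| < e / 2, so |A'| is at most the derivative of g = - (e / 2) / (1 - cos).
    Comparing from a fixed point [x0] gives (1 - cos x) |A x| <= (1 - cos x) |A x0| + e / 2, and the
    first term tends to 0. *)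
Lemma pole_growth N A :
  (forall x, 0 < x < pi -> is_derive x 1 A (- (N x * sin x / (1 - cos x) ^+ 2))) ->
  N x @[x --> 0^'+] --> (0 : R) -> (1 - cos x) * A x @[x --> 0^'+] --> (0 : R).
Proof.
move=> HA N0; apply/cvgrPdist_lt => e e0.
have [d /andP[d0 dp] Hd] := cvg0_near N0 (divr_gt0 e0 (ltr0n _ 2)).
have cp x : 0 < x < d -> 0 < 1 - cos x.
  by move=> /andP[? ?]; rewrite subr_gt0; apply: cos_lt1_oo; apply/andP; split; lra.
pose g x := - (e / 2) * (1 - cos x)^-1.
have Hg x : 0 < x < d -> is_derive x 1 g (e / 2 * (sin x / (1 - cos x) ^+ 2)).
  move=> xd; have := cp x xd => ?.
  by apply: der_eq (derM (der_cst _ _) (derV _ (der_1Bcos x))) _ ; [lra|field; lra].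
pose x0 := d / 2.
have : (1 - cos x) * `|A x0| @[x --> 0^'+] --> (0 : R).
  rewrite -[X in _ --> X](mul0r `|A x0|); apply: cvgM; last exact: cvg_cst.
  by rewrite -[X in _ --> X](subrr 1); apply: cvgB; [exact: cvg_cst|exact: cvg_cos0].
move=> /cvg0_near /(_ (divr_gt0 e0 (ltr0n _ 2)))[d' /andP[d'0 d'p] Hd'].
near=> x.
have x_gt0 : 0 < x by near: x; exact: nbhs_right_gt.
have xx0 : x <= x0 by near: x; apply: nbhs_right_le; rewrite /x0; lra.
have xd' : x < d' by near: x; exact: nbhs_right_lt.
have x0d : x0 < d by rewrite /x0; lra.
rewrite sub0r normrN normrM.
have cx := cp x; have {}cx : 0 < 1 - cos x by apply: cx; apply/andP; split; lra.
have cx0 : 0 < 1 - cos x0 by apply: cp; apply/andP; split; lra.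
rewrite gtr0_norm//.
have H1 : `|A x0 - A x| <= g x0 - g x.
  apply: (@der_dominated _ 0 d _ _ _ _ _ Hg) => //.
    by move=> z /andP[z0 zd]; apply: HA; apply/andP; split; lra.
  move=> z zd; have zN := Hd z zd; have zc := cp z zd.
  have zs : 0 < sin z by apply: sin_gt0; move: zd => /andP[? ?]; apply/andP; split; lra.
  have K : 0 <= sin z / (1 - cos z) ^+ 2 by rewrite divr_ge0 ?ltW// exprn_gt0.
  by rewrite normrN -mulrA normrM (ger0_norm K); apply: ler_wpM2r => //; exact: ltW.
have H2 := Hd' x; have {}H2 : (1 - cos x) * `|A x0| < e / 2.
  by apply: le_lt_trans (H2 _); [exact: ler_norm|apply/andP; split; lra].
have H3 : `|A x| <= `|A x0| + `|A x0 - A x|.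
  by rewrite -[X in `|X| <= _](subKr (A x0)) (le_trans (ler_normB _ _)).
have gx : (1 - cos x) * g x = - (e / 2) by rewrite /g; field; lra.
have gx0 : g x0 <= 0 by rewrite /g mulNr oppr_le0 mulr_ge0 ?invr_ge0; lra.
by nra.
Unshelve. all: by end_near. Qed.

(** L'Hopital against 1 - cos, whose derivative is sin: B' / sin = N / (1 + cos)^2 tends to 0. *)
Lemma pole_decay N B :
  (forall x, 0 < x < pi -> is_derive x 1 B (N x * sin x / (1 + cos x) ^+ 2)) ->
  B x @[x --> 0^'+] --> (0 : R) ->
  N x @[x --> 0^'+] --> (0 : R) -> B x / (1 - cos x) @[x --> 0^'+] --> (0 : R).
Proof.
move=> HB B0 N0; have p0 : 0 < pi :> R := pi_gt0 R.
have df_dg : (N x * sin x / (1 + cos x) ^+ 2) / sin x @[x --> 0^'+] --> (0 : R).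
  have H : N x / (1 + cos x) ^+ 2 @[x --> 0^'+] --> (0 : R).
    rewrite -[X in _ --> X](mul0r ((1 + 1) ^+ 2)^-1); apply: cvgM => //.
    apply: cvgV; first by rewrite expf_neq0.
    have H1 : 1 + cos x @[x --> 0^'+] --> (1 + 1 : R).
      by apply: cvgD; [exact: cvg_cst|exact: cvg_cos0].
    exact: (cvgM H1 H1).
  apply: cvg_trans H; apply: near_eq_cvg; near=> x.
  have xp : 0 < x < pi by near: x; exact: near0_pi.
  have s0 := sin_gt0 xp; have cx : -1 < cos x.
    by apply: cos_gtN1_oo; move: xp => /andP[? ?]; apply/andP; split; lra.
  by field; apply/andP; split; apply/eqP; lra.
apply: (@lhopital_at_right _ B (fun x => N x * sin x / (1 + cos x) ^+ 2)
   (fun x => 1 - cos x) sin 0 pi) => //.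
- by move=> x xp; exact: der_1Bcos.
- by rewrite -[X in _ --> X](subrr 1); apply: cvgB; [exact: cvg_cst|exact: cvg_cos0].
- by move=> x; rewrite in_itv /= => /sin_gt0; lra.
Unshelve. all: by end_near. Qed.

(** The derivative of exp(W) sin is exp(W) (G / sin^2 + cos), which is nonnegative close to 0, where
    |G / sin^2| < 1/2 < cos. Hence exp(W) sin stays bounded there, and the two remaining factors sin
    tend to 0. *)
Lemma pole_exp W G :
  (forall x, 0 < x < pi -> is_derive x 1 W (G x / sin x ^+ 3)) ->
  G x / sin x ^+ 2 @[x --> 0^'+] --> (0 : R) ->
  expR (W x) * sin x ^+ 3 @[x --> 0^'+] --> (0 : R).
Proof.
move=> HW G0; have h2 : 0 < 2^-1 :> R by rewrite invr_gt0.
have [d1 /andP[d10 d1p] Hd1] := cvg0_near G0 h2.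
have : 1 - cos x @[x --> 0^'+] --> (0 : R).
  by rewrite -[X in _ --> X](subrr 1); apply: cvgB; [exact: cvg_cst|exact: cvg_cos0].
move=> /cvg0_near /(_ h2) [d2 /andP[d20 d2p] Hd2].
pose d := Num.min d1 d2.
have [d0 dd1 dd2] : [/\ 0 < d, d <= d1 & d <= d2].
  by rewrite /d lt_min d10 d20 !ge_min !lexx orbT.
have Hf x : 0 < x < d -> is_derive x 1 (fun t => expR (W t) * sin t)
    (expR (W x) * (G x / sin x ^+ 2 + cos x)).
  move=> /andP[x0 xd]; have xp : 0 < x < pi by apply/andP; split; lra.
  have := sin_gt0 xp => s0.
  apply: der_eq (derM (der_comp (is_derive_expR _) (HW x xp)) (is_derive_sin x)) _.
  by field; lra.
pose C := expR (W (d / 2)) * sin (d / 2).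
apply: (@squeeze_cvgr _ _ _ _ (cst 0) (fun x => C * sin x ^+ 2)).
- near=> x.
  have xp : 0 < x < pi by near: x; exact: near0_pi.
  have xd : x <= d / 2 by near: x; apply: nbhs_right_le; lra.
  have s0 := sin_gt0 xp; have e0 := expR_ge0 (W x).
  apply/andP; split; first by apply: mulr_ge0 => //; apply: exprn_ge0; exact: ltW.
  have -> : expR (W x) * sin x ^+ 3 = expR (W x) * sin x * sin x ^+ 2 by ring.
  apply: ler_wpM2r; first by apply: exprn_ge0; exact: ltW.
  move: xp => /andP[x0 xp].
  apply: (der_mono Hf) => //; last lra.
  move=> z /andP[z0 zd]; rewrite mulr_ge0 ?expR_ge0//.
  have := Hd1 z; have := Hd2 z; rewrite !ltr_norml => h h'.
  have /andP[? ?] : - 2^-1 < 1 - cos z < 2^-1 by apply: h; apply/andP; split; lra.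
  have /andP[? ?] : - 2^-1 < G z / sin z ^+ 2 < 2^-1 by apply: h'; apply/andP; split; lra.
  lra.
- exact: cvg_cst.
- have S2 : sin x ^+ 2 @[x --> 0^'+] --> (0 : R).
    by rewrite -[X in _ --> X](mulr0 0); exact: (cvgM cvg_sin0 cvg_sin0).
  by rewrite -[X in _ --> X](mulr0 C); apply: cvgM => //; exact: cvg_cst.
Unshelve. all: by end_near. Qed.

(** |W| <= exp(W) + exp(-W), and [pole_exp] applies to both W and -W. *)
Lemma pole_log W G :
  (forall x, 0 < x < pi -> is_derive x 1 W (G x / sin x ^+ 3)) ->
  G x / sin x ^+ 2 @[x --> 0^'+] --> (0 : R) ->
  W x * sin x ^+ 3 @[x --> 0^'+] --> (0 : R).
Proof.
move=> HW G0; have P := pole_exp HW G0.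
have M : expR (- W x) * sin x ^+ 3 @[x --> 0^'+] --> (0 : R).
  apply: (@pole_exp (fun x => - W x) (fun x => - G x)) => [x xp|].
    by apply: der_eq (derN (HW x xp)) _; rewrite mulNr.
  rewrite -[X in _ --> X]oppr0; under eq_fun do rewrite mulNr.
  exact: cvgN.
have PM : expR (W x) * sin x ^+ 3 + expR (- W x) * sin x ^+ 3 @[x --> 0^'+] --> (0 : R).
  by rewrite -[X in _ --> X](addr0 0); exact: cvgD.
apply: (@squeeze_cvgr _ _ _ _
  (fun x => - (expR (W x) * sin x ^+ 3 + expR (- W x) * sin x ^+ 3))
  (fun x => expR (W x) * sin x ^+ 3 + expR (- W x) * sin x ^+ 3)) => //.
- near=> x.
  have xp : 0 < x < pi by near: x; exact: near0_pi.
  have s0 : 0 < sin x ^+ 3 by rewrite exprn_gt0// sin_gt0.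
  have := expR_ge1Dx (W x); have := expR_ge1Dx (- W x).
  have := expR_ge0 (W x); have := expR_ge0 (- W x) => *.
  by rewrite -mulrDl -mulNr; apply/andP; split; apply: ler_wpM2r; rewrite ?ltW//; lra.
- by rewrite -[X in _ --> X]oppr0; exact: cvgN.
Unshelve. all: by end_near. Qed.

End poles.

(** * The Green function *)

Section profile.
Context {R : realType}.
Implicit Types (x : R) (N A B F D V : R -> R).

(* With [x = cos t], [F = (1 - x^2)^2 u'] as a function of [t], [D] and [D2] are
   [dF/dx] and [d^2F/dx^2], whence the factors [- sin t = dx/dt]. *)
Record profile N F D D2 V : Prop := Profile {
  der_F : forall x, 0 < x < pi -> is_derive x 1 F (- sin x * D x);
  der_D : forall x, 0 < x < pi -> is_derive x 1 D (- sin x * D2 x);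
  der_V : forall x, 0 < x < pi -> is_derive x 1 V (- F x / sin x ^+ 3);
  profile_ode : forall x, 0 < x < pi ->
    sin x ^+ 2 * D2 x + 2 * cos x * D x - 2 * F x = N x;
  der_D2 : forall x nu, 0 < x < pi -> is_derive x 1 N (- sin x ^+ 3 * nu) ->
    is_derive x 1 D2 (- sin x * nu);
  cvg_F0 : F x / sin x ^+ 2 @[x --> 0^'+] --> (0 : R);
  cvg_D0 : D x @[x --> 0^'+] --> (0 : R);
  cvg_Fpi : F x / sin x ^+ 2 @[x --> pi^'-] --> (0 : R);
  cvg_Dpi : D x @[x --> pi^'-] --> (0 : R) }.

(* Variation of constants with the solutions [(1 - x)^2] and [(1 + x)^2] of
   [(1 - x^2) y'' + 2 x y' - 2 y = 0]. *)
Definition greenF A B x : R :=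
  - 4^-1 * ((1 - cos x) ^+ 2 * A x + (1 + cos x) ^+ 2 * B x).
Definition greenD A B x : R := 2^-1 * ((1 - cos x) * A x - (1 + cos x) * B x).

Lemma sin_pos_cos x : 0 < x < pi -> [/\ 0 < sin x, 0 < 1 - cos x & 0 < 1 + cos x].
Proof.
move=> xp; have c1 : cos x < 1.
  by apply: cos_lt1_oo; move: xp => /andP[? ?]; apply/andP; split; lra.
have c2 : -1 < cos x.
  by apply: cos_gtN1_oo; move: xp => /andP[? ?]; apply/andP; split; lra.
by split; [exact: sin_gt0|lra|lra].
Qed.

Lemma green_cvg0 N A B :
  (forall x, 0 < x < pi -> is_derive x 1 A (- (N x * sin x / (1 - cos x) ^+ 2))) ->
  (forall x, 0 < x < pi -> is_derive x 1 B (N x * sin x / (1 + cos x) ^+ 2)) ->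
  B x @[x --> 0^'+] --> (0 : R) -> N x @[x --> 0^'+] --> (0 : R) ->
  greenF A B x / sin x ^+ 2 @[x --> 0^'+] --> (0 : R) /\
  greenD A B x @[x --> 0^'+] --> (0 : R).
Proof.
move=> HA HB B0 N0; have PA := pole_growth HA N0; have PB := pole_decay HB B0 N0.
have C1 : 1 + cos x @[x --> 0^'+] --> (1 + 1 : R).
  by apply: cvgD; [exact: cvg_cst|exact: cvg_cos0].
split; last first.
  rewrite -[X in _ --> X](mulr0 2^-1); apply: cvgM; first exact: cvg_cst.
  by rewrite -[X in _ --> X](subr0 0) -[X in _ --> _ - X](mulr0 (1 + 1)); apply: cvgB => //; exact: cvgM.
have H : - 4^-1 * ((1 - cos x) * A x / (1 + cos x) + (1 + cos x) * (B x / (1 - cos x)))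
    @[x --> 0^'+] --> (0 : R).
  rewrite -[X in _ --> X](mulr0 (- 4^-1)); apply: cvgM; first exact: cvg_cst.
  rewrite -[X in _ --> X](addr0 0) -[X in _ --> X + _](mul0r (1 + 1)^-1).
  rewrite -[X in _ --> _ + X](mulr0 (1 + 1)); apply: cvgD; last exact: cvgM.
  by apply: cvgM => //; apply: cvgV.
apply: cvg_trans H; apply: near_eq_cvg; near=> x.
have [s0 c1 c2] : [/\ 0 < sin x, 0 < 1 - cos x & 0 < 1 + cos x].
  by apply: sin_pos_cos; near: x; exact: near0_pi.
by rewrite sin2E /greenF; field; apply/andP; split; apply/eqP; lra.
Unshelve. all: by end_near. Qed.

Lemma continuous_green N x : continuous N ->
  (1 - cos x != 0 -> {for x, continuous (fun t => - (N t * sin t / (1 - cos t) ^+ 2))}) /\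
  (1 + cos x != 0 -> {for x, continuous (fun t => N t * sin t / (1 + cos t) ^+ 2)}).
Proof.
move=> cN; have K (g : R -> R) : continuous g -> g x != 0 ->
    {for x, continuous (fun t => N t * sin t / g t ^+ 2)}.
  move=> cg gx; apply: cvgM; first by apply: cvgM; [exact: cN|exact: continuous_sin].
  apply: cvgV; first by rewrite expf_neq0.
  exact: (cvgM (cg x) (cg x)).
split=> cx; last by apply: K => // t; apply: cvgD; [exact: cvg_cst|exact: continuous_cos].
by apply: cvgN; apply: K => // t; apply: cvgB; [exact: cvg_cst|exact: continuous_cos].
Qed.

Lemma cvg_reflect_pi (f : R -> R) : {for pi, continuous f} ->
  f (pi - t) @[t --> 0^'+] --> f pi.
Proof.
move=> cf; apply: cvg_at_right_filter.
have h : pi - t @[t --> (0 : R)] --> (pi : R).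
  by rewrite -[X in _ --> X]subr0; apply: cvgB; [exact: cvg_cst|exact: cvg_id].
exact: cvg_comp h cf.
Qed.

(** The Wronskian of (1 - x)^2 and (1 + x)^2 is 4 (1 - x^2); this accounts for the factor - 1/4 in
    [greenF] and for the derivatives prescribed for [A] and [B]. Each constant of integration is
    fixed at one pole: [A] vanishes at [pi] and [B] at 0. *)
Lemma profile_exists N : continuous N -> N 0 = 0 -> N pi = 0 ->
  exists F D D2 V, profile N F D D2 V.
Proof.
move=> cN N0 Npi; have p0 : 0 < pi :> R := pi_gt0 R.
(* The integrand is regular at [pi]; taking the primitive up to [2 * pi] makes [A0] continuous at
   [pi], where it is normalized. The interval ]-pi, pi[ plays the same part for [B0] at 0. *)
have [A0 HA0] : exists G, forall x, 0 < x < 2 * pi ->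
    is_derive x 1 G (- (N x * sin x / (1 - cos x) ^+ 2)).
  apply: antiderivative_oo; first by rewrite mulr_gt0.
  by move=> x /cos_lt1_oo c1; apply: (continuous_green x cN).1; apply/eqP; lra.
have [B0 HB0] : exists G, forall x, - pi < x < pi ->
    is_derive x 1 G (N x * sin x / (1 + cos x) ^+ 2).
  apply: antiderivative_oo; first by lra.
  by move=> x /cos_gtN1_oo c1; apply: (continuous_green x cN).2; apply/eqP; lra.
pose A x := A0 x - A0 pi; pose B x := B0 x - B0 0.
have HA x : 0 < x < 2 * pi -> is_derive x 1 A (- (N x * sin x / (1 - cos x) ^+ 2)).
  by move=> /HA0 h; apply: der_eq (derB h (der_cst _ _)) _; rewrite subr0.
have HB x : - pi < x < pi -> is_derive x 1 B (N x * sin x / (1 + cos x) ^+ 2).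
  by move=> /HB0 h; apply: der_eq (derB h (der_cst _ _)) _; rewrite subr0.
have HA' x : 0 < x < pi -> is_derive x 1 A (- (N x * sin x / (1 - cos x) ^+ 2)).
  by move=> /andP[? ?]; apply: HA; apply/andP; split; lra.
have HB' x : 0 < x < pi -> is_derive x 1 B (N x * sin x / (1 + cos x) ^+ 2).
  by move=> /andP[? ?]; apply: HB; apply/andP; split; lra.
have [F0 D0] : greenF A B x / sin x ^+ 2 @[x --> 0^'+] --> (0 : R) /\
    greenD A B x @[x --> 0^'+] --> (0 : R).
  apply: (green_cvg0 HA' HB').
    have /HB0/der_continuous h : - pi < (0 : R) < pi by apply/andP; split; lra.
    by apply: cvg_at_right_filter; rewrite -[X in _ --> X](subrr (B0 0)); apply: cvgB => //; exact: cvg_cst.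
  by apply: cvg_at_right_filter; rewrite -[X in _ --> X]N0; exact: cN.
have cr x : cos (pi - x) = - cos x by rewrite cosB cospi sinpi; ring.
have sr x : sin (pi - x) = sin x by rewrite sinB cospi sinpi; ring.
(* The pole [pi] is brought to 0 by the reflection t -> pi - t, under which [A] and [B] exchange
   their roles. *)
have [Fp Dp] : greenF (fun t => B (pi - t)) (fun t => A (pi - t)) x / sin x ^+ 2
      @[x --> 0^'+] --> (0 : R) /\
    greenD (fun t => B (pi - t)) (fun t => A (pi - t)) x @[x --> 0^'+] --> (0 : R).
  apply: (@green_cvg0 (fun t => N (pi - t))).
  - move=> x xp; have /HB' h : 0 < pi - x < pi by move: xp => /andP[? ?]; apply/andP; split; lra.
    by apply: der_eq (der_refl h) _; rewrite cr sr.
  - move=> x xp; have /HA' h : 0 < pi - x < pi by move: xp => /andP[? ?]; apply/andP; split; lra.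
    by apply: der_eq (der_refl h) _; rewrite cr sr !opprK.
  - have /HA0/der_continuous h : 0 < (pi : R) < 2 * pi by apply/andP; split; lra.
    rewrite -[X in _ --> X](subrr (A0 pi)).
    by apply: cvgB; [exact: cvg_reflect_pi|exact: cvg_cst].
  - by rewrite -[X in _ --> X]Npi; apply: cvg_reflect_pi; exact: cN.
have dF x : 0 < x < pi -> is_derive x 1 (greenF A B) (- sin x * greenD A B x).
  move=> xp; have [s0 c1 c2] := sin_pos_cos xp.
  have dc : is_derive x 1 (fun t => 1 + cos t) (- sin x).
    by apply: der_eq (derD (der_cst _ _) (is_derive_cos x)) _; rewrite add0r.
  apply: der_eq (derM (der_cst _ _) (derD (derM (derX 2 (der_1Bcos x)) (HA' _ xp))
    (derM (derX 2 dc) (HB' _ xp)))) _.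
  by rewrite /greenD; field; apply/andP; split; apply/eqP; lra.
pose D2 x := - 2^-1 * (A x + B x) + N x / sin x ^+ 2.
have dD x : 0 < x < pi -> is_derive x 1 (greenD A B) (- sin x * D2 x).
  move=> xp; have [s0 c1 c2] := sin_pos_cos xp.
  have dc : is_derive x 1 (fun t => 1 + cos t) (- sin x).
    by apply: der_eq (derD (der_cst _ _) (is_derive_cos x)) _; rewrite add0r.
  apply: der_eq (derM (der_cst _ _) (derB (derM (der_1Bcos x) (HA' _ xp))
    (derM dc (HB' _ xp)))) _.
  by rewrite /D2 sin2E; field; apply/andP; split; apply/eqP; lra.
have [V HV] : exists V, forall x, 0 < x < pi ->
    is_derive x 1 V (- greenF A B x / sin x ^+ 3).
  apply: antiderivative_oo => // x xp; have [s0 _ _] := sin_pos_cos xp.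
  apply: cvgM; first by apply: cvgN; exact: der_continuous (dF _ xp).
  apply: cvgV; first by rewrite expf_neq0// gt_eqF.
  have cs := @continuous_sin R x; exact: (cvgM cs (cvgM cs cs)).
exists (greenF A B), (greenD A B), D2, V; split; [exact: dF|exact: dD|exact: HV| | |exact: F0|exact: D0| |].
- move=> x xp; have [s0 c1 c2] := sin_pos_cos xp.
  by rewrite /D2 sin2E /greenF /greenD; field; apply/andP; split; apply/eqP; lra.
(* Here [nu] stands for F''', which exists wherever [N] is differentiable; [N] itself is only
   assumed continuous. *)
- move=> x nu xp HN; have [s0 c1 c2] := sin_pos_cos xp.
  have s2 : sin x ^+ 2 != 0 by rewrite expf_neq0// gt_eqF.
  have K := derV (f := fun t => sin t ^+ 2) s2 (derX 2 (is_derive_sin x)).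
  have K2 := derD (derM (der_cst x (- 2^-1)) (derD (HA' _ xp) (HB' _ xp))) (derM HN K).
  apply: der_eq K2 _.
  have -> : N x * sin x / (1 + cos x) ^+ 2 =
    N x * sin x / (1 - cos x) ^+ 2 - 4 * N x * cos x / sin x ^+ 3.
    have -> : sin x ^+ 3 = (1 - cos x) ^+ 2 * (1 + cos x) ^+ 2 / sin x.
      by rewrite -exprMn -sin2E; field; lra.
    by field; apply/and3P; split; apply/eqP; lra.
  by field; apply/andP; split; apply/eqP; lra.
- apply: cvg_at_left_refl; apply: cvg_trans Fp; apply: near_eq_cvg; apply: nearW => x.
  by rewrite /greenF cr sr; congr (_ / _); ring.
- apply: cvg_at_left_refl; rewrite -[X in _ --> X]oppr0.
  apply: cvg_trans (cvgN Dp); apply: near_eq_cvg; apply: nearW => x.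
  rewrite /greenD cr [LHS](_ : _ =
    - (2^-1 * ((1 - cos x) * B (pi - x) - (1 + cos x) * A (pi - x)))) //.
  by ring.
Qed.

End profile.

(** * The weak equation *)

Section weak_form.
Context {R : realType}.
Notation mu := (@lebesgue_measure R).
Implicit Types (x : R) (N A B F D V : R -> R) (p : {poly R}).

(** The bound variable [zonal_laplace] is here a real number, the limit of [H] at [b], and shadows
    the differential operator. [G] extends [H] by its one-sided limits, so the values of [H] at the
    ends are irrelevant. *)
Lemma FTC2_oo (H h : R -> R) (a b la zonal_laplace : R) : a < b ->
  {within `[a, b], continuous h} ->
  (forall x, a < x < b -> is_derive x 1 H (h x)) ->
  H x @[x --> a^'+] --> la -> H x @[x --> b^'-] --> zonal_laplace ->
  \int[mu]_(x in `[a, b]) h x = zonal_laplace - la.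
Proof.
move=> ab ch dH Ha Hb.
pose G x := if x == a then la else if x == b then zonal_laplace else H x.
have GH x : a < x < b -> \near x, H x = G x.
  move=> /andP[ax xb]; near=> z; rewrite /G gt_eqF ?lt_eqF//; near: z.
    exact: lt_nbhsl.
  exact: lt_nbhsr.
have dG x : a < x < b -> is_derive x 1 G (h x).
  by move=> xab; apply: near_eq_is_derive (GH x xab) (dH x xab).
have Ga : G a = la by rewrite /G eqxx.
have Gb : G b = zonal_laplace by rewrite /G eqxx gt_eqF.
rewrite -Ga -Gb /Rintegral (@continuous_FTC2 _ h G a b) //.
- split; first by move=> x; rewrite in_itv/= => /dG[].
  + rewrite Ga; apply: cvg_trans Ha; apply: near_eq_cvg; near=> z.
    by rewrite /G gt_eqF ?lt_eqF.
  + rewrite Gb; apply: cvg_trans Hb; apply: near_eq_cvg; near=> z.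
    by rewrite /G gt_eqF ?lt_eqF.
- by move=> x; rewrite in_itv/= => /dG[_ <-]; rewrite derive1E.
Unshelve. all: by end_near. Qed.

(* With [q = p'], [flux p = (1 - x^2)^2 ((1 - x^2) q'' - 6 x q' - 6 q)] satisfies
   [int u (1 - x^2) P_4 p = - int u' flux p]. *)
Definition flux p : {poly R} :=
  (1 - 'X^2) ^+ 2 * 
    ((1 - 'X^2) * p^`()^`()^`() - 6%:R *: ('X * p^`()^`()) - 6%:R *: p^`()).

Lemma deriv_flux p x : (flux p)^`().[x] = (1 - x ^+ 2) * (zonal_paneitz p).[x].
Proof.
have d1 : (1 : {poly R})^`() = 0 by exact: derivC.
rewrite /flux /zonal_paneitz /zonal_laplace expr2 
  !(derivB, derivD, derivM, derivZ, derivX, d1, deriv0, mulr1, mul1r) !hornerE.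
by rewrite /=; ring.
Qed.

Lemma cvg_within_cc (f : R -> R) (a b : R) : a < b ->
  (forall x, a < x < b -> {for x, continuous f}) ->
  f x @[x --> a^'+] --> f a -> f x @[x --> b^'-] --> f b ->
  {within `[a, b], continuous f}.
Proof.
move=> ab cf fa fb; apply/continuous_within_itvP => //; split => //.
Qed.

Lemma profile_addc N F D D2 V c : profile N F D D2 V ->
  profile N F D D2 (fun x => V x + c).
Proof.
case=> h1 h2 h3 h4 h5 h6 h7 h8 h9; split => // x xp.
by apply: der_eq (derD (h3 _ xp) (der_cst _ _)) _; rewrite addr0.
Qed.

Lemma cvg_at_right_refl (c l : R) (f : R -> R) :
  f x @[x --> c^'-] --> l -> f (c - x) @[x --> 0^'+] --> l.
Proof.
move=> /cvgrPdist_lt H; apply/cvgrPdist_lt => e e0.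
have [d /= d0 Hd] := H e e0.
exists d => //= y; rewrite /= sub0r normrN => yd y0.
by apply: Hd; rewrite /= ?subKr// ltrBlDr ltrDl.
Qed.

(** The operator (1 - x^2) F'' + 2 x F' - 2 F commutes with x -> -x, so [F] and [N] are carried over
    with their sign, whereas F = (1 - x^2)^2 V' forces [V] to change sign. *)
Lemma profile_refl N F D D2 V : profile N F D D2 V ->
  profile (fun x => N (pi - x)) (fun x => F (pi - x)) (fun x => - D (pi - x))
    (fun x => D2 (pi - x)) (fun x => - V (pi - x)).
Proof.
have cr x : cos (pi - x) = - cos x :> R by rewrite cosB cospi sinpi; ring.
have sr x : sin (pi - x) = sin x :> R by rewrite sinB cospi sinpi; ring.
have rp x : 0 < x < pi -> 0 < pi - x < pi.
  by move=> /andP[? ?]; apply/andP; split; lra.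
case=> h1 h2 h3 h4 h5 h6 h7 h8 h9; split.
- by move=> x xp; apply: der_eq (der_refl (h1 _ (rp _ xp))) _; rewrite sr /=; ring.
- by move=> x xp; apply: der_eq (derN (der_refl (h2 _ (rp _ xp)))) _; rewrite sr /=; ring.
- by move=> x xp; apply: der_eq (derN (der_refl (h3 _ (rp _ xp)))) _; rewrite sr /=; ring.
- by move=> x xp; rewrite -h4 ?rp// sr cr /=; ring.
- move=> x nu xp HN; apply: der_eq (der_refl (h5 _ (- nu) (rp _ xp) _)) _; last by rewrite sr /=; ring.
  have : is_derive (pi - x) 1 (fun t => N (pi - (pi - t))) (- (- sin x ^+ 3 * nu)).
    by apply: (@der_refl _ (pi - x) pi (fun t => N (pi - t))); rewrite subKr.
  rewrite (_ : (fun t => N (pi - (pi - t))) = N); last by apply/funext => t; rewrite subKr.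
  by move=> K; apply: der_eq K _; rewrite sr /=; ring.
- by have := cvg_at_right_refl h8; under eq_fun do rewrite sr.
- by rewrite -[X in _ --> X]oppr0; apply: cvgN; exact: cvg_at_right_refl.
- by apply: cvg_at_left_refl; under eq_fun do rewrite subKr sr.
- by apply: cvg_at_left_refl; rewrite -[X in _ --> X]oppr0; apply: cvgN; under eq_fun do rewrite subKr.
Qed.

Lemma profile_V_cvg0 N F D D2 V : profile N F D D2 V ->
  V x * sin x ^+ 3 @[x --> 0^'+] --> (0 : R) /\
  V x * sin x ^+ 3 @[x --> pi^'-] --> (0 : R).
Proof.
have K N' F' D' D2' V' : profile N' F' D' D2' V' ->
    V' x * sin x ^+ 3 @[x --> 0^'+] --> (0 : R).
  move=> P; apply: (@pole_log _ V' (fun x => - F' x)); first exact: der_V P.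
  rewrite -[X in _ --> X]oppr0; under eq_fun do rewrite mulNr.
  by apply: cvgN; exact: cvg_F0 P.
move=> P; split; first exact: K P.
have H : - (- V (pi - x) * sin x ^+ 3) @[x --> 0^'+] --> - (0 : R).
  exact: cvgN (K _ _ _ _ _ (profile_refl P)).
rewrite oppr0 in H.
apply: cvg_at_left_refl; apply: cvg_trans H; apply: near_eq_cvg; apply: nearW => x.
by rewrite sinB cospi sinpi; ring.
Qed.

Lemma profile_weak N F D D2 V p : continuous N -> profile N F D D2 V ->
  \int[mu]_(x in `[0, pi]) (V x * (zonal_paneitz p).[cos x] * sin x ^+ 3) =
  - \int[mu]_(x in `[0, pi]) (N x * (p^`().[cos x] * sin x)).
Proof.
move=> cN P; have p0 : 0 < pi :> R := pi_gt0 R.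
have [V0 Vp] := profile_V_cvg0 P.
have cB (q : {poly R}) x : {for x, continuous (fun t => q.[cos t])}.
  exact: continuous_horner_cos.
have cs3 x : {for x, continuous (fun t : R => sin t ^+ 3)}.
  by have cs := @continuous_sin R x; exact: (cvgM cs (cvgM cs cs)).
have lim0 (a : R) (FF : set_system R) (f g : R -> R) : Filter FF ->
    f x @[x --> FF] --> (0 : R) -> g x @[x --> FF] --> a -> f x * g x @[x --> FF] --> (0 : R).
  by move=> ? fa ga; rewrite -[X in _ --> X](mul0r a); exact: cvgM.
pose h1 x := V x * (zonal_paneitz p).[cos x] * sin x ^+ 3.
have c1 : {within `[0, pi], continuous h1}.
  apply: cvg_within_cc => //.
  - move=> x xp; apply: cvgM; last exact: cs3.
    by apply: cvgM; [exact: der_continuous (der_V P xp)|exact: cB].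
  - rewrite /h1 sin0 expr0n mulr0; under eq_fun do rewrite mulrAC.
    by apply: (lim0 _ _ _ _ _ V0); apply: cvg_at_right_filter; exact: cB.
  - rewrite /h1 sinpi expr0n mulr0; under eq_fun do rewrite mulrAC.
    by apply: (lim0 _ _ _ _ _ Vp); apply: cvg_at_left_filter; exact: cB.
pose h2 x := N x * (p^`().[cos x] * sin x).
have c2 : continuous h2.
  by move=> x; apply: cvgM; [exact: cN|apply: cvgM; [exact: cB|exact: continuous_sin]].
have i1 : mu.-integrable `[0, pi] (EFin \o h1).
  by apply: continuous_compact_integrable => //; exact: segment_compact.
have i2 : mu.-integrable `[0, pi] (EFin \o h2).
  apply: continuous_compact_integrable; first exact: segment_compact.
  exact: continuous_subspaceT.
apply/eqP; rewrite -addr_eq0 -RintegralD//; apply/eqP.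
set q := p^`().
(* In the variable x the derivative of [H] is V (1 - x^2) P_4 p + N q. The reason is that the
   bracket in [flux] is the formal adjoint of (1 - x^2) F'' + 2 x F' - 2 F applied to q; the last
   three terms of [H] are the boundary terms of this duality. *)
pose H x := V x * (flux p).[cos x] - (1 - cos x ^+ 2) * F x * q^`().[cos x]
  + (1 - cos x ^+ 2) * D x * q.[cos x] + 4 * cos x * F x * q.[cos x].
have dH x : 0 < x < pi -> is_derive x 1 H (- (h1 x + h2 x)).
  move=> xp; have [s0 _ _] := sin_pos_cos xp.
  have dF := der_F P xp; have dD := der_D P xp; have dV := der_V P xp.
  have dc := is_derive_cos x.
  have dw : is_derive x 1 (fun t => 1 - cos t ^+ 2) (2 * cos x * sin x).
    by apply: der_eq (derB (der_cst _ _) (derX 2 dc)) _; rewrite /=; ring.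
  apply: der_eq (derD (derD (derB (derM dV (der_horner_cos x (flux p)))
    (derM (derM dw dF) (der_horner_cos x q^`())))
    (derM (derM dw dD) (der_horner_cos x q)))
    (derM (derM (derM (der_cst _ _) dc) dF) (der_horner_cos x q))) _.
  rewrite deriv_flux /h1 /h2 -(profile_ode P xp).
  have w : 1 - cos x ^+ 2 = sin x ^+ 2 by rewrite sin2E; ring.
  have -> : (flux p).[cos x] = sin x ^+ 4 *
      (sin x ^+ 2 * q^`()^`().[cos x] - 6 * (cos x * q^`().[cos x]) - 6 * q.[cos x]).
    by rewrite /flux -/q !hornerE w; ring.
  by rewrite !w -/q; field; lra.
have w x : 1 - cos x ^+ 2 = sin x ^+ 2 by rewrite sin2E; ring.
have fl x : (flux p).[cos x] = sin x ^+ 3 * (sin x *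
    ((1 - cos x ^+ 2) * q^`()^`().[cos x] - 6 * (cos x * q^`().[cos x]) - 6 * q.[cos x])).
  by rewrite /flux -/q !hornerE w /=; ring.
pose T : {poly R} := (1 - 'X^2) * q^`()^`() - 6%:R *: ('X * q^`()) - 6%:R *: q.
have TE x : T.[cos x] =
    (1 - cos x ^+ 2) * q^`()^`().[cos x] - 6 * (cos x * q^`().[cos x]) - 6 * q.[cos x].
  by rewrite /T !hornerE; ring.
have Hlim (FF : set_system R) (a : R) : Filter FF ->
    (forall r : {poly R}, r.[cos x] @[x --> FF] --> r.[a]) ->
    sin x @[x --> FF] --> (0 : R) -> (\forall x \near FF, sin x != 0) ->
    V x * sin x ^+ 3 @[x --> FF] --> (0 : R) ->
    F x / sin x ^+ 2 @[x --> FF] --> (0 : R) -> D x @[x --> FF] --> (0 : R) ->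
    H x @[x --> FF] --> (0 : R).
  move=> ? cr s0 sn0 v0 f0 d0.
  (* [H] is rewritten so that each term has one of the vanishing factors V sin^3, F / sin^2 and D,
     times a factor with a limit. *)
  have Z : V x * sin x ^+ 3 * (sin x * T.[cos x])
      - F x / sin x ^+ 2 * (sin x * (sin x * ((1 - 'X^2) * q^`()).[cos x]))
      + D x * ((1 - 'X^2) * q).[cos x]
      + F x / sin x ^+ 2 * (sin x * (sin x * (4%:R *: ('X * q)).[cos x])) @[x --> FF] --> (0 : R).
    rewrite -[X in _ --> X](addr0 0); apply: cvgD.
      rewrite -[X in _ --> X](addr0 0); apply: cvgD; last by apply: lim0 d0 (cr _).
      rewrite -[X in _ --> X](subr0 0); apply: cvgB.
        by apply: lim0 v0 (lim0 _ _ _ _ _ s0 (cr _)).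
      by apply: lim0 f0 (lim0 _ _ _ _ _ s0 (lim0 _ _ _ _ _ s0 (cr _))).
    by apply: lim0 f0 (lim0 _ _ _ _ _ s0 (lim0 _ _ _ _ _ s0 (cr _))).
  apply: cvg_trans Z; apply: near_eq_cvg; near=> x.
  have sx : sin x != 0 by near: x.
  rewrite /H fl TE !hornerE !w /=.
  move: sx (cos x) (V x) (F x) (D x) (q.[cos x]) (q^`().[cos x]) (q^`()^`().[cos x]).
  move: (sin x) => s sx c v f d q0 q1 q2.
  by field.
have sn x : 0 < x < pi -> sin x != 0 by move=> xp; rewrite gt_eqF// sin_gt0.
have H0 : H x @[x --> 0^'+] --> (0 : R).
  apply: (Hlim _ (cos 0)) => //.
  - by move=> r; apply: cvg_at_right_filter; exact: cB.
  - exact: cvg_sin0.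
  - by near=> x; apply: sn; near: x; exact: near0_pi.
  - exact: cvg_F0 P.
  - exact: cvg_D0 P.
have Hpi : H x @[x --> pi^'-] --> (0 : R).
  apply: (Hlim _ (cos pi)) => //.
  - by move=> r; apply: cvg_at_left_filter; exact: cB.
  - by apply: cvg_at_left_filter; rewrite -[X in _ --> X]sinpi; exact: continuous_sin.
  - near=> x; apply: sn; apply/andP; split; near: x; first exact: nbhs_left_gt.
    exact: nbhs_left_lt.
  - exact: cvg_Fpi P.
  - exact: cvg_Dpi P.
have c12 : {within `[0, pi], continuous (fun x => h1 x + h2 x)}.
  move=> x; apply: cvgD; first exact: c1.
  exact: (continuous_subspaceT c2).
have := FTC2_oo p0 c12 (H := fun x => - H x) (la := 0) (zonal_laplace := 0).
rewrite subr0; apply.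
- by move=> x xp; rewrite -[X in is_derive _ _ _ X]opprK; apply: derN; exact: dH.
- by rewrite -[X in _ --> X]oppr0; exact: cvgN.
- by rewrite -[X in _ --> X]oppr0; exact: cvgN.
Unshelve. all: by end_near. Qed.

End weak_form.

(** * Uniqueness up to a constant, through polynomial moments *)

Section uniqueness.
Context {R : realType}.
Notation mu := (@lebesgue_measure R).
Implicit Types (x : R) (N F D V : R -> R) (p : {poly R}).

Lemma coef_zonal_laplace p i : (zonal_laplace p)`_i = (i.+2 * i.+1)%:R * p`_i.+2 - (i * (i + 3))%:R * p`_i.
Proof.
have D (q : {poly R}) j : q^`()`_j = q`_j.+1 * j.+1%:R by rewrite coef_deriv mulr_natr.
rewrite /zonal_laplace mulrBl mul1r !coefB coefZ coefXnM coefXM.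
case: i => [|[|i]] /=; rewrite ?subn2 /= !D !natrM ?natrD -?natr1; ring.
Qed.

(** P_4 is triangular on polynomials, with eigenvalue n (n + 1) (n + 2) (n + 3) in degree n.
    Allowing all [i >= n] includes the vanishing coefficients above the degree, so that subtracting
    the eigenvalue times [p] lowers the size. *)
Lemma coef_zonal_paneitz p n i : (size p <= n.+1)%N -> (n <= i)%N ->
  (zonal_paneitz p)`_i = (n * n.+1 * n.+2 * n.+3)%:R * p`_i.
Proof.
move=> sp ni; rewrite /zonal_paneitz coefB coefZ !coef_zonal_laplace.
have z j : (n < j)%N -> p`_j = 0.
  by move=> nj; rewrite nth_default// (leq_trans sp).
have -> : p`_i.+2 = 0 by rewrite z// ltnS (leq_trans ni).
have -> : p`_i.+4 = 0 by rewrite z// ltnS (leq_trans ni)// -addn3 leq_addr.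
have [<-|nei] := eqVneq n i.
  by rewrite !natrM -!natr1 natrD; ring.
have -> : p`_i = 0 by apply: z; rewrite ltn_neqAle nei.
by ring.
Qed.

Lemma integral_sin3 : \int[mu]_(t in `[0, pi]) (sin t ^+ 3) = 4 / 3.
Proof.
have cs : continuous (fun t : R => sin t ^+ 3).
  by move=> x; have cs := @continuous_sin R x; exact: (cvgM cs (cvgM cs cs)).
pose P : {poly R} := 3^-1 *: 'X^3 - 'X.
have cP : continuous (fun t : R => P.[cos t]) by exact: continuous_horner_cos.
have dP x : 0 < x < pi -> is_derive x 1 (fun t => P.[cos t]) (sin x ^+ 3).
  move=> _; apply: der_eq (der_horner_cos x P) _.
  rewrite /P !(derivB, derivZ, derivXn, derivX) !hornerE exprS sin2E /=.
  by field.
have := FTC2_oo (pi_gt0 R) (continuous_subspaceT cs) dP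
  (cvg_at_right_filter (cP 0)) (cvg_at_left_filter (cP pi)).
by move=> ->; rewrite cos0 cospi /P !hornerE /=; lra.
Qed.

(** With its weight, U - V - c is orthogonal to the range of P_4 and to 1. Together these span all
    polynomials, since only the constants have eigenvalue 0, and a function without polynomial
    moments in cos t vanishes almost everywhere. *)
Lemma profile_unique N F D D2 V (U : R -> R) : continuous N -> profile N F D D2 V ->
  mu.-integrable `[0, pi] (EFin \o (fun t => U t * sin t ^+ 3)) ->
  (forall p, \int[mu]_(x in `[0, pi]) (U x * (zonal_paneitz p).[cos x] * sin x ^+ 3) =
  - \int[mu]_(x in `[0, pi]) (N x * (p^`().[cos x] * sin x))) ->
  exists c, {ae mu, forall t, 0 < t < pi -> U t = V t + c}.
Proof.
move=> cN P iU wU; have p0 : 0 < pi :> R := pi_gt0 R.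
have cs3 : continuous (fun t : R => sin t ^+ 3).
  by move=> x; have cs := @continuous_sin R x; exact: (cvgM cs (cvgM cs cs)).
have is3 : mu.-integrable `[0, pi] (EFin \o (fun t => sin t ^+ 3)).
  apply: continuous_compact_integrable; first exact: segment_compact.
  exact: continuous_subspaceT.
have iV : mu.-integrable `[0, pi] (EFin \o (fun t => V t * sin t ^+ 3)).
  apply: continuous_compact_integrable; first exact: segment_compact.
  have [V0 Vp] := profile_V_cvg0 P.
  apply: cvg_within_cc => //.
  - by move=> x xp; apply: cvgM; [exact: der_continuous (der_V P xp)|exact: cs3].
  - by rewrite sin0 expr0n mulr0.
  - by rewrite sinpi expr0n mulr0.
have mI : measurable (`[0%R, pi]%classic : set R) by [].
have ip (h : R -> R) p : mu.-integrable `[0, pi] (EFin \o h) ->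
    mu.-integrable `[0, pi] (EFin \o (fun t => h t * p.[cos t])).
  exact: integrable_mulr_horner_cos.
(* The difference of the means of U and V for the weight sin^3, whose total mass is 4 / 3; it makes
   [L 1] vanish. *)
pose c := (\int[mu]_(t in `[0, pi]) (U t * sin t ^+ 3) -
  \int[mu]_(t in `[0, pi]) (V t * sin t ^+ 3)) / (4 / 3).
pose h t := U t * sin t ^+ 3 - (V t + c) * sin t ^+ 3.
have iVc : mu.-integrable `[0, pi] (EFin \o (fun t => (V t + c) * sin t ^+ 3)).
  rewrite (_ : (fun t => _) = (fun t => V t * sin t ^+ 3 + c * sin t ^+ 3)).
    by apply: integrable_addr => //; exact: integrable_scaler.
  by apply/funext => t; rewrite mulrDl.
have ih : mu.-integrable `[0, pi] (EFin \o h).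
  exact: integrable_subr.
pose L p := \int[mu]_(t in `[0, pi]) (h t * p.[cos t]).
have LD p q : L (p + q) = L p + L q.
  rewrite /L -RintegralD ?ip//; apply: eq_Rintegral => t _.
  by rewrite hornerD mulrDr.
have LZ a p : L (a *: p) = a * L p.
  rewrite /L -RintegralZl ?ip//; apply: eq_Rintegral => t _.
  by rewrite hornerZ mulrCA.
have LUV p : L p = \int[mu]_(t in `[0, pi]) (U t * p.[cos t] * sin t ^+ 3) -
    \int[mu]_(t in `[0, pi]) ((V t + c) * p.[cos t] * sin t ^+ 3).
  under [X in _ = X - _]eq_Rintegral do rewrite mulrAC.
  under [X in _ = _ - X]eq_Rintegral do rewrite mulrAC.
  rewrite -RintegralB ?ip//; apply: eq_Rintegral => t _.
  by rewrite /h mulrBl.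
have Lpan p : L (zonal_paneitz p) = 0.
  by rewrite LUV wU (profile_weak p cN (profile_addc c P)) subrr.
have L1 : L 1 = 0.
  rewrite LUV; under eq_Rintegral do rewrite hornerC mulr1.
  under [X in _ - X]eq_Rintegral do rewrite hornerC mulr1 mulrDl.
  rewrite RintegralD//; last exact: integrable_scaler.
  by rewrite RintegralZl// integral_sin3 /c; field.
have Lsize n p : (size p <= n)%N -> L p = 0.
  elim: n p => [|n IH] p sp.
    have -> : p = 0 by apply/eqP; rewrite -size_poly_eq0 -leqn0.
    by rewrite -(scale0r 0) LZ mul0r.
  (* Constants are treated apart, the eigenvalue of degree 0 not being invertible. *)
  case: n => [|n] in IH sp *.
    by rewrite (size1_polyC sp) -alg_polyC LZ L1 mulr0.
  pose lam : R := (n.+1 * n.+2 * n.+3 * n.+4)%:R.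
  have lam0 : lam != 0 by rewrite pnatr_eq0.
  have H : L (zonal_paneitz p - lam *: p) = 0.
    apply: IH; apply/leq_sizeP => i ni.
    by rewrite coefB coefZ (coef_zonal_paneitz sp ni) subrr.
  move: H; rewrite LD Lpan add0r -scaleNr LZ mulNr => /eqP.
  by rewrite oppr_eq0 mulf_eq0 (negbTE lam0) => /eqP.
exists c; move: (moments_cos_eq0 ih (fun p => Lsize _ p (leqnn _))).
apply: filterS; first exact: (ae_filter_ringOfSetsType mu).
move=> t ht tp.
have := ht tp; rewrite /h -mulrBl => /eqP; rewrite mulf_eq0 subr_eq0.
by rewrite expf_eq0 /= (gt_eqF (sin_gt0 tp)) orbF => /eqP.
Qed.

End uniqueness.

(** * The Pohozaev identity *)

Section rigidity.
Context {R : realType}.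
Implicit Types (x : R) (N F D V : R -> R).

(** This concludes from the sign of the derivative of the Pohozaev function without integrating it
    over ]0, pi[. *)
Lemma nondecreasing_cvg0_eq0 (f : R -> R) (a b : R) :
  (forall x y, a < x -> x <= y -> y < b -> f x <= f y) ->
  f x @[x --> a^'+] --> (0 : R) -> f x @[x --> b^'-] --> (0 : R) ->
  forall x, a < x < b -> f x = 0.
Proof.
move=> nf fa fb x /andP[ax xb]; apply/eqP; rewrite eq_le; apply/andP; split.
  rewrite leNgt; apply/negP => fx.
  move/cvgrPdist_lt : fb => /(_ _ fx) H.
  near b^'- => z.
  have /ltW xz : x < z by near: z; exact: nbhs_left_gt.
  have zb : z < b by near: z; exact: nbhs_left_lt.
  have : `|0 - f z| < f x by near: z.
  by rewrite sub0r normrN ltNge (le_trans (nf _ _ ax xz zb))// ler_norm.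
rewrite leNgt; apply/negP => fx.
move/cvgrPdist_lt : fa; rewrite -oppr_gt0 in fx; move=> /(_ _ fx) H.
near a^'+ => z.
have az : a < z by near: z; exact: nbhs_right_gt.
have /ltW zx : z < x by near: z; exact: nbhs_right_lt.
have : `|0 - f z| < - f x by near: z.
by rewrite sub0r ltNge (le_trans _ (ler_norm _))// lerN2 nf.
Unshelve. all: by end_near. Qed.

(* A primitive of [- 6 F'^2] in the variable [x]; the term in [E = C e^{4V}]
   comes from [4 x F E = (x (1 - x^2)^2 E)' - (1 - x^2) (1 - 5 x^2) E]. *)
Definition pohozaev (E F D D2 : R -> R) x : R :=
  4 * cos x * F x * D2 x - 4 * F x * D x - 2 * cos x * D x ^+ 2
  + sin x ^+ 2 * (1 - 5 * cos x ^+ 2) * D2 x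
  - (20 * cos x ^+ 3 - 12 * cos x) * D x
  + (60 * cos x ^+ 2 - 12) * F x + (30 - E x) * cos x * sin x ^+ 4.

Lemma der_pohozaev C N F D D2 V x : profile N F D D2 V ->
  (forall x, 0 < x < pi ->
    is_derive x 1 N (- sin x ^+ 3 * (C * expR (4 * V x) - 30))) ->
  0 < x < pi ->
  is_derive x 1 (pohozaev (fun t => C * expR (4 * V t)) F D D2) (6 * sin x * D x ^+ 2).
Proof.
move=> P HN xp; have [s0 _ _] := sin_pos_cos xp.
have dF := der_F P xp; have dD := der_D P xp; have dV := der_V P xp.
have dD2 := der_D2 P xp (HN x xp).
have dc := is_derive_cos x; have ds := is_derive_sin x.
have dE := derM (der_cst x C) (der_comp (is_derive_expR _) (derM (der_cst x 4) dV)).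
have K := derD (derD (derB (derD (derB (derB
  (derM (derM (derM (der_cst x 4) dc) dF) dD2)
  (derM (derM (der_cst x 4) dF) dD))
  (derM (derM (der_cst x 2) dc) (derX 2 dD)))
  (derM (derM (derX 2 ds) (derB (der_cst x 1) (derM (der_cst x 5) (derX 2 dc)))) dD2))
  (derM (derB (derM (der_cst x 20) (derX 3 dc)) (derM (der_cst x 12) dc)) dD))
  (derM (derB (derM (der_cst x 60) (derX 2 dc)) (der_cst x 12)) dF))
  (derM (derM (derB (der_cst x 30) dE) dc) (derX 4 ds)).
apply: der_eq K _ => /=.
move: (expR _) (F x) (D x) (D2 x) => e f d d2.
(* The identity holds only modulo cos^2 + sin^2 = 1; the second term is the multiple of that
   relation which makes it a plain identity for [field]. *)
transitivity (6 * sin x * d ^+ 2 + (cos x ^+ 2 + sin x ^+ 2 - 1) *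
    (10 * sin x * cos x * d2 + sin x ^+ 3 * (C * e - 30))).
  by field; lra.
by rewrite cos2Dsin2 subrr mul0r addr0.
Qed.

Lemma pohozaev_cvg0 C N F D D2 V (FF : set_system R) (a : R) : Filter FF ->
  (forall x, 0 < x < pi ->
    sin x ^+ 2 * D2 x + 2 * cos x * D x - 2 * F x = N x) ->
  (\forall x \near FF, 0 < x < pi) ->
  cos x @[x --> FF] --> a -> sin x @[x --> FF] --> (0 : R) ->
  N x @[x --> FF] --> (0 : R) -> F x / sin x ^+ 2 @[x --> FF] --> (0 : R) ->
  D x @[x --> FF] --> (0 : R) ->
  expR (4 * V x) * sin x ^+ 3 @[x --> FF] --> (0 : R) ->
  pohozaev (fun t => C * expR (4 * V t)) F D D2 x @[x --> FF] --> (0 : R).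
Proof.
move=> ? ode npi ca s0 n0 f0 d0 e0.
have lim0 (b : R) (f g : R -> R) : f x @[x --> FF] --> (0 : R) ->
    g x @[x --> FF] --> b -> f x * g x @[x --> FF] --> (0 : R).
  by move=> fa ga; rewrite -[X in _ --> X](mul0r b); exact: cvgM.
have lim0D (f g : R -> R) : f x @[x --> FF] --> (0 : R) ->
    g x @[x --> FF] --> (0 : R) -> f x + g x @[x --> FF] --> (0 : R).
  by move=> fa ga; rewrite -[X in _ --> X](addr0 0); exact: cvgD.
have cp (p : {poly R}) : p.[cos x] @[x --> FF] --> p.[a].
  exact: (continuous_cvg _ (@continuous_horner _ p a) ca).
have F0 : F x / sin x ^+ 2 * (sin x * sin x) @[x --> FF] --> (0 : R).
  exact: lim0 f0 (cvgM s0 s0).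
(* By the differential equation [W] is sin^2 * D2. No bound on [D2] itself is at hand at the poles,
   so F * D2 is read as (F / sin^2) * W. *)
pose W x := N x + D x * (- 2%:R *: 'X).[cos x]
  + F x / sin x ^+ 2 * (sin x * sin x) * (2%:P).[cos x].
have W0 : W x @[x --> FF] --> (0 : R).
  apply: (@lim0D); last exact: lim0 F0 (cp _).
  by apply: (@lim0D) => //; exact: lim0 d0 (cp _).
have Z : F x / sin x ^+ 2 * (W x * (4%:R *: 'X).[cos x])
    + F x / sin x ^+ 2 * (sin x * sin x) * (D x * (- 4%:P).[cos x])
    + D x * (D x * (- 2%:R *: 'X).[cos x]) + W x * (1 - 5%:R *: 'X^2).[cos x]
    + D x * (12%:R *: 'X - 20%:R *: 'X^3).[cos x]
    + F x / sin x ^+ 2 * (sin x * sin x) * (60%:R *: 'X^2 - 12%:P).[cos x]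
    + sin x * (sin x * (sin x * (sin x * (30%:R *: 'X).[cos x])))
    + expR (4 * V x) * sin x ^+ 3 * (sin x * (- C *: 'X).[cos x])
    @[x --> FF] --> (0 : R).
  do !apply: (@lim0D).
  - exact: lim0 f0 (cvgM W0 (cp _)).
  - exact: lim0 F0 (cvgM d0 (cp _)).
  - exact: lim0 d0 (cvgM d0 (cp _)).
  - exact: lim0 W0 (cp _).
  - exact: lim0 d0 (cp _).
  - exact: lim0 F0 (cp _).
  - exact: lim0 s0 (cvgM s0 (cvgM s0 (cvgM s0 (cp _)))).
  - exact: lim0 e0 (cvgM s0 (cp _)).
apply: cvg_trans Z; apply: near_eq_cvg; near=> x.
have xp : 0 < x < pi by near: x.
have s_gt0 := sin_gt0 xp.
rewrite /W -(ode x xp) /pohozaev !hornerE /=.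
move: (expR _) (F x) (D x) (D2 x) (cos x) => e f d d2 c.
by move: (sin x) s_gt0 => s s_gt0; field; lra.
Unshelve. all: by end_near. Qed.

Lemma profile_exp_cvg0 N F D D2 V : profile N F D D2 V ->
  expR (4 * V x) * sin x ^+ 3 @[x --> 0^'+] --> (0 : R) /\
  expR (4 * V x) * sin x ^+ 3 @[x --> pi^'-] --> (0 : R).
Proof.
have K k N' F' D' D2' V' : profile N' F' D' D2' V' ->
    expR (k * V' x) * sin x ^+ 3 @[x --> 0^'+] --> (0 : R).
  move=> P; apply: (@pole_exp _ (fun t => k * V' t) (fun t => - k * F' t)).
    move=> x xp; apply: der_eq (derM (der_cst x k) (der_V P xp)) _; ring.
  have H : - k * (F' x / sin x ^+ 2) @[x --> 0^'+] --> - k * 0.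
    by apply: cvgM; [exact: cvg_cst|exact: cvg_F0 P].
  rewrite mulr0 in H; apply: cvg_trans H; apply: near_eq_cvg; apply: nearW => x.
  by rewrite mulrA.
move=> P; split; first exact: K P.
(* The reflected profile carries - V, whence the exponent - 4. *)
apply: cvg_at_left_refl; have H := K (- 4) _ _ _ _ _ (profile_refl P).
apply: cvg_trans H; apply: near_eq_cvg; apply: nearW => x.
by rewrite mulrNN sinB cospi sinpi; congr (_ * _ ^+ 3); ring.
Qed.

Lemma profile_rigid C N F D D2 V : continuous N -> N 0 = 0 -> N pi = 0 ->
  profile N F D D2 V ->
  (forall x, 0 < x < pi ->
    is_derive x 1 N (- sin x ^+ 3 * (C * expR (4 * V x) - 30))) ->
  forall x y, 0 < x < pi -> 0 < y < pi -> V x = V y.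
Proof.
move=> cN N0 Npi P HN.
pose Phi := pohozaev (fun t => C * expR (4 * V t)) F D D2.
have dPhi x : 0 < x < pi -> is_derive x 1 Phi (6 * sin x * D x ^+ 2).
  by move=> xp; exact: der_pohozaev P HN xp.
have [e0 epi] := profile_exp_cvg0 P.
have n0 : \forall x \near (0 : R)^'+, 0 < x < pi by exact: near0_pi.
have npi : \forall x \near (pi : R)^'-, 0 < x < pi.
  near=> x; apply/andP; split; near: x; first by apply: nbhs_left_gt; exact: pi_gt0.
  exact: nbhs_left_lt.
have Phi0 x : 0 < x < pi -> Phi x = 0.
  apply: (@nondecreasing_cvg0_eq0 Phi 0 pi).
  - apply: (der_mono dPhi) => z zp.
    by rewrite mulr_ge0 ?sqr_ge0// mulr_ge0// ltW// sin_gt0.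
  - apply: (pohozaev_cvg0 C _ (profile_ode P) n0 cvg_cos0 cvg_sin0 _ (cvg_F0 P) (cvg_D0 P) e0).
    by apply: cvg_at_right_filter; rewrite -[X in _ --> X]N0; exact: cN.
  - apply: (pohozaev_cvg0 C _ (profile_ode P) npi _ _ _ (cvg_Fpi P) (cvg_Dpi P) epi).
    + by apply: cvg_at_left_filter; exact: continuous_cos.
    + by apply: cvg_at_left_filter; rewrite -[X in _ --> X]sinpi; exact: continuous_sin.
    + by apply: cvg_at_left_filter; rewrite -[X in _ --> X]Npi; exact: cN.
have D0 x : 0 < x < pi -> D x = 0.
  move=> xp; have [_ E] := dPhi x xp.
  have Z : 'D_1 Phi x = 0.
    rewrite (near_eq_derive (g := cst 0)) ?derive_cst//.
    move: (xp) => /andP[x0 xpi]; near=> z; rewrite Phi0//.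
    by apply/andP; split; near: z; [exact: lt_nbhsr|exact: lt_nbhsl].
  move: E; rewrite Z => /eqP; rewrite eq_sym mulf_eq0 sqrf_eq0 mulf_eq0 pnatr_eq0 /=.
  by rewrite (gt_eqF (sin_gt0 xp)) /= => /eqP.
have Fcst x y : 0 < x < pi -> 0 < y < pi -> F x = F y.
  by apply: der0_cst => z zp; apply: der_eq (der_F P zp) _; rewrite D0// mulr0.
have F0 x : 0 < x < pi -> F x = 0.
  move=> xp; have : F z @[z --> 0^'+] --> (0 : R).
    have H : F z / sin z ^+ 2 * (sin z * sin z) @[z --> 0^'+] --> (0 * (0 * 0) : R).
      exact: cvgM (cvg_F0 P) (cvgM cvg_sin0 cvg_sin0).
    rewrite !mul0r in H; apply: cvg_trans H; apply: near_eq_cvg; near=> z.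
    have zp : 0 < z < pi by near: z.
    by have s_gt0 := sin_gt0 zp; move: (F z) => f; rewrite -expr2 divfK// gt_eqF// exprn_gt0.
  move=> H; have H2 : F z @[z --> 0^'+] --> F x.
    by apply: cvg_near_cst; near=> z; apply: Fcst => //; near: z.
  exact: (cvg_unique _ H2 H).
apply: der0_cst => z zp; apply: der_eq (der_V P zp) _.
by rewrite F0// oppr0 mul0r.
Unshelve. all: by end_near. Qed.

End rigidity.

(** * Product measures *)

Section tensor.
Context d1 d2 (X : measurableType d1) (Y : measurableType d2) (R : realType).
Variables (m1 : {sigma_finite_measure set X -> \bar R})
  (m2 : {sigma_finite_measure set Y -> \bar R}).
Implicit Types (f : X -> R) (g : Y -> R) (A : set X) (B : set Y).

(** Extension by 0 respects products, which reduces integrals over A x B to integrals over the whole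
    space. *)
Lemma patch_tensor f g A B (z : X * Y) :
  ((fun z => f z.1 * g z.2) \_ (A `*` B)) z = (f \_ A) z.1 * (g \_ B) z.2.
Proof.
rewrite !patchE in_setX.
by case: (z.1 \in A); case: (z.2 \in B); rewrite /= ?mul0r ?mulr0.
Qed.

Lemma measurable_tensor f g : measurable_fun setT f -> measurable_fun setT g ->
  measurable_fun setT (fun z : X * Y => f z.1 * g z.2).
Proof.
move=> mf mg; apply: measurable_funM.
  by apply: (measurableT_comp mf); exact: measurable_fst.
by apply: (measurableT_comp mg); exact: measurable_snd.
Qed.

Lemma measurable_tensor_on f g A B : measurable A -> measurable B ->
  measurable_fun A f -> measurable_fun B g ->
  measurable_fun (A `*` B) (fun z : X * Y => f z.1 * g z.2).
Proof.
move=> mA mB mf mg; apply: measurable_funM.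
  apply: (@measurable_comp _ _ _ _ _ _ A f (A `*` B) fst) => //.
    by move=> _ [[x y] [/= Ax _] <-].
  by apply: measurable_funTS; exact: measurable_fst.
apply: (@measurable_comp _ _ _ _ _ _ B g (A `*` B) snd) => //.
  by move=> _ [[x y] [/= _ By] <-].
by apply: measurable_funTS; exact: measurable_snd.
Qed.

Lemma integral_abs_tensor f g : measurable_fun setT f -> measurable_fun setT g ->
  (\int[m1]_x \int[m2]_y `|(f x * g y)%:E| =
   (\int[m1]_x `|(f x)%:E|) * (\int[m2]_y `|(g y)%:E|))%E.
Proof.
move=> mf mg.
have mf' : measurable_fun setT (fun x => `|(f x)%:E|)%E.
  by apply: measurableT_comp => //; exact/measurable_EFinP.
have mg' : measurable_fun setT (fun x => `|(g x)%:E|)%E.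
  by apply: measurableT_comp => //; exact/measurable_EFinP.
under eq_integral => x _.
  under eq_integral do rewrite EFinM abseM.
  rewrite ge0_integralZl//.
  over.
by rewrite ge0_integralZr// integral_ge0.
Qed.

Lemma integrable_tensorT f g :
  m1.-integrable setT (EFin \o f) -> m2.-integrable setT (EFin \o g) ->
  (m1 \x m2)%E.-integrable setT (EFin \o (fun z => f z.1 * g z.2)).
Proof.
move=> /integrableP[/measurable_EFinP mf If] /integrableP[/measurable_EFinP mg Ig].
apply/integrable12ltyP.
  by apply/measurable_EFinP; exact: measurable_tensor.
rewrite [X in (X < _)%E](integral_abs_tensor mf mg).
apply: lte_mul_pinfty => //; first exact: integral_ge0.
by rewrite ge0_fin_numE// integral_ge0.
Qed.

Lemma Rintegral_tensorT f g :
  m1.-integrable setT (EFin \o f) -> m2.-integrable setT (EFin \o g) ->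
  Rintegral (m1 \x m2)%E setT (fun z => f z.1 * g z.2) =
  Rintegral m1 setT f * Rintegral m2 setT g.
Proof.
move=> If Ig; have H := integrable_tensorT If Ig.
rewrite /Rintegral -(integral12_prod_meas1 H) /fubini_F /=.
under eq_integral => x _.
  under eq_integral do rewrite EFinM.
  rewrite integralZl// -(fineK (integrable_fin_num _ Ig))//.
  over.
rewrite integralZr// fineM//; first exact: integrable_fin_num.
Qed.

Lemma integrable_tensor f g A B : measurable A -> measurable B ->
  m1.-integrable A (EFin \o f) -> m2.-integrable B (EFin \o g) ->
  (m1 \x m2)%E.-integrable (A `*` B) (EFin \o (fun z => f z.1 * g z.2)).
Proof.
move=> mA mB If Ig; apply/(integrable_mkcond _ (measurableX mA mB)).
rewrite restrict_EFin (funext (patch_tensor f g A B)).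
by apply: integrable_tensorT; rewrite -restrict_EFin;
  [exact: (integrable_mkcond _ mA).1|exact: (integrable_mkcond _ mB).1].
Qed.

Lemma Rintegral_tensor f g A B : measurable A -> measurable B ->
  m1.-integrable A (EFin \o f) -> m2.-integrable B (EFin \o g) ->
  Rintegral (m1 \x m2)%E (A `*` B) (fun z => f z.1 * g z.2) =
  Rintegral m1 A f * Rintegral m2 B g.
Proof.
move=> mA mB If Ig; rewrite Rintegral_mkcond (funext (patch_tensor f g A B)).
rewrite [in RHS]Rintegral_mkcond [in X in _ = _ * X]Rintegral_mkcond.
by apply: Rintegral_tensorT; rewrite -restrict_EFin;
  [exact: (integrable_mkcond _ mA).1|exact: (integrable_mkcond _ mB).1].
Qed.

(** By Tonelli the integral of |f g| is the product of those of |f| and |g|. The latter is positive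
    because the integral of [g] is not 0, so the former must be finite. *)
Lemma integrable_tensor_l f g A B : measurable A -> measurable B ->
  measurable_fun A f -> m2.-integrable B (EFin \o g) -> Rintegral m2 B g != 0 ->
  (m1 \x m2)%E.-integrable (A `*` B) (EFin \o (fun z => f z.1 * g z.2)) ->
  m1.-integrable A (EFin \o f).
Proof.
move=> mA mB mf Ig g0 If.
have mfA : measurable_fun setT (f \_ A) by exact/(measurable_restrictT _ mA).
have mgB : measurable_fun setT (g \_ B).
  by apply/(measurable_restrictT _ mB)/measurable_EFinP; exact: measurable_int Ig.
move: If => /(integrable_mkcond _ (measurableX mA mB)).
rewrite restrict_EFin (funext (patch_tensor f g A B)) => If.
have mT := measurable_tensor mfA mgB.
have H : (\int[m1]_x \int[m2]_y `|((f \_ A) x * (g \_ B) y)%:E| < +oo)%E.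
  by apply: (integrable12ltyP m1 m2 _).1 If; exact/measurable_EFinP.
rewrite (integral_abs_tensor mfA mgB) in H.
apply/(integrable_mkcond _ mA); rewrite restrict_EFin.
apply/integrableP; split; first exact/measurable_EFinP.
have IgB : m2.-integrable setT (EFin \o (g \_ B)).
  by rewrite -restrict_EFin; exact: (integrable_mkcond _ mB).1.
have g_gt0 : (0 < \int[m2]_y `|((g \_ B) y)%:E|)%E.
  apply: lt_le_trans (le_abse_integral _ _ _) => //; last exact: measurable_int IgB.
  rewrite lt0e abse_ge0 andbT abse_eq0; apply: contra g0 => /eqP g0.
  by rewrite Rintegral_mkcond /Rintegral [X in fine X]g0.
rewrite ltey; apply/eqP => E; move: H; rewrite E.
by rewrite gt0_mulye.
Qed.

(** [m1 \x m2] integrates the sections at fixed x; uniqueness of the product measure allows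
    integrating the measures of the sections at fixed y instead, and a nonnegative function of
    integral 0 is 0 almost everywhere. *)
Lemma ae_ysection (P : X * Y -> Prop) : {ae (m1 \x m2)%E, forall z, P z} ->
  {ae m2, forall y, {ae m1, forall x, P (x, y)}}.
Proof.
move=> [A [mA A0 PA]].
have A0' : (\int[m2]_y m1 (ysection A y) = 0)%E.
  rewrite -A0; apply/esym.
  apply: (@product_measure_unique _ _ _ _ _ m1 m2 (m1 \x^ m2)%E) => // B C mB mC.
  exact: product_measure2E.
have mY : measurable_fun setT (fun y => m1 (ysection A y)).
  exact: measurable_fun_ysection.
have : ae_eq m2 setT (fun y => m1 (ysection A y)) (cst 0%E).
  apply/(ae_eq_integral_abs m2 measurableT mY).
  by under eq_integral do rewrite gee0_abs//.
apply: filterS => y /(_ I) y0; exists (ysection A y); split => //.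
  exact: measurable_ysection.
by move=> x /= nP; rewrite /ysection /= inE; apply: PA.
Qed.

Lemma ae_fst (P : X -> Prop) : {ae m1, forall x, P x} ->
  {ae (m1 \x m2)%E, forall z, P z.1}.
Proof.
move=> [A [mA A0 PA]]; exists (A `*` setT); split.
- exact: measurableX.
- by rewrite [LHS]product_measure1E// [X in (X * _)%E]A0 mul0e.
- by move=> [x y] /= nP; split => //; apply: PA.
Qed.

Lemma sigma_finite_prod : sigma_finite setT (m1 \x m2)%E.
Proof.
have /sigma_finiteP[F [UF ndF fF]] := sigma_finiteT m1.
have /sigma_finiteP[G [UG ndG fG]] := sigma_finiteT m2.
exists (fun n => F n `*` G n); last first.
  move=> n; have [mF oF] := fF n; have [mG oG] := fG n.
  split; first exact: measurableX.
  by rewrite [X in (X < _)%E]product_measure1E// lte_mul_pinfty// ge0_fin_numE.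
apply/seteqP; split => // -[x y] _.
have [i _ Fx] : (\bigcup_n F n) x by rewrite -UF.
have [j _ Gy] : (\bigcup_n G n) y by rewrite -UG.
exists (maxn i j) => //; split.
  by have /subsetPset := ndF _ _ (leq_maxl i j); exact.
by have /subsetPset := ndG _ _ (leq_maxr i j); exact.
Qed.

(* The canonical instance found for [m1 \x m2] is the one for probabilities. *)
Definition sigma_finite_product : {sigma_finite_measure set (X * Y)%type -> \bar R} :=
  HB.pack (product_measure1 m1 m2)
    (Measure_isSigmaFinite.Build _ _ _ (product_measure1 m1 m2) sigma_finite_prod).

End tensor.

(** * The one-dimensional problem *)

Section one_dimensional.
Context {R : realType}.
Notation mu := (@lebesgue_measure R).
Implicit Types (x y : R) (p : {poly R}).

(** Integration by parts for a merely integrable [m]: Fubini on the triangle 0 <= y <= x <= b. *)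
Lemma integral_primitive_mul (m k K : R -> R) (b : R) : 0 < b ->
  mu.-integrable `[0, b] (EFin \o m) -> continuous k ->
  (forall x, is_derive x 1 K (k x)) ->
  \int[mu]_(x in `[0, b]) (k x * \int[mu]_(y in `[0, x]) m y) =
  \int[mu]_(y in `[0, b]) (m y * (K b - K y)).
Proof.
move=> b0 im ck dK.
have mI (a c : R) : measurable (`[a, c]%classic : set R) by [].
have ik (a c : R) : mu.-integrable `[a, c] (EFin \o k).
  by apply: continuous_compact_integrable; [exact: segment_compact|exact: continuous_subspaceT].
have iT (f : R -> R) (a c : R) : mu.-integrable `[a, c] (EFin \o f) ->
    mu.-integrable setT (EFin \o (f \_ `[a, c])).
  by move=> If; rewrite -restrict_EFin; apply/(integrable_mkcond _ _).1.
have valT (f : R -> R) (a c e : R) : mu.-integrable `[a, c] (EFin \o f) ->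
    (\int[mu]_x (e * (f \_ `[a, c]) x)%:E = (e * \int[mu]_(x in `[a, c]) f x)%:E)%E.
  move=> If; under eq_integral do rewrite EFinM.
  rewrite integralZl//; last exact: iT.
  rewrite EFinM; congr (_ * _)%E; rewrite Rintegral_mkcond /Rintegral fineK//.
  by apply: integrable_fin_num => //; exact: iT.
pose G (z : R * R) :=
  ((k \_ `[0, b]) z.1 * (m \_ `[0, b]) z.2) * (if z.2 <= z.1 then 1 else 0).
have iG : (mu \x mu)%E.-integrable setT (EFin \o G).
  apply: (@integrable_mulr_bounded _ _ _ _ _ _ _ 1) => //.
  - by apply: integrable_tensorT; exact: iT.
  - apply: measurable_fun_ifT => //.
    by apply: measurable_fun_ler; [exact: measurable_snd|exact: measurable_fst].
  - by move=> z _; case: ifP; rewrite ?normr1 ?normr0.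
have := Fubini iG.
have E1 x : (\int[mu]_y (G (x, y))%:E =
      (((fun x => k x * \int[mu]_(y in `[0, x]) m y) \_ `[0, b]) x)%:E)%E.
  rewrite patchE; case: ifPn => [|xb]; last first.
    rewrite [LHS]integral0_eq// => y _.
    by rewrite /G /= patchE (negbTE xb) !mul0r.
  rewrite inE /= in_itv /= => /andP[x0 xb].
  rewrite -valT; last by apply: integrableS im => //; apply: subset_itvl; rewrite bnd_simp.
  apply: eq_integral => y _; rewrite /G /= !patchE -mulrA; congr (_ * _)%:E.
    by rewrite mem_set//= in_itv /= x0.
  rewrite !mem_setE !in_itv /=.
  by have [yx|xy] := leP y x; rewrite ?(le_trans yx xb) ?andbF ?mulr0// andbT mulr1.
under eq_integral do rewrite E1.
have E2 y : (\int[mu]_x (G (x, y))%:E =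
      (((fun y => m y * (K b - K y)) \_ `[0, b]) y)%:E)%E.
  rewrite patchE; case: ifPn => [|yb]; last first.
    rewrite [LHS]integral0_eq// => x _.
    by rewrite /G /= [X in _ * X * _]patchE (negbTE yb) mulr0 mul0r.
  rewrite inE /= in_itv /= => /andP[y0 yb].
  have -> : K b - K y = \int[mu]_(x in `[y, b]) k x.
    have [->|yb'] := eqVneq y b; first by rewrite subrr set_itv1 Rintegral_set1.
    apply/esym/FTC2_oo; rewrite ?lt_neqAle ?yb'//.
    - exact: continuous_subspaceT.
    - by apply: cvg_at_right_filter; apply: der_continuous (dK _).
    - by apply: cvg_at_left_filter; apply: der_continuous (dK _).
  rewrite -valT//.
  apply: eq_integral => x _; rewrite /G /= !patchE mulrAC mulrC; congr (_ * _)%:E.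
    by rewrite mem_set//= in_itv /= y0.
  rewrite !mem_setE !in_itv /=.
  by have [yx|xy] := leP y x; rewrite ?(le_trans y0 yx) ?andbF ?mulr0//= mulr1.
under [X in _ = X -> _]eq_integral do rewrite E2.
move=> H; rewrite Rintegral_mkcond [RHS]Rintegral_mkcond.
by rewrite /Rintegral H.
Qed.

(** [profile_exists] needs continuity on the whole line, since its primitives run past the poles;
    the primitive of [m] is extended by clamping its argument to [0, b]. *)
Lemma primitive_continuous_ext (m : R -> R) (b : R) : 0 < b ->
  mu.-integrable `[0, b] (EFin \o m) -> \int[mu]_(y in `[0, b]) m y = 0 ->
  exists N : R -> R, [/\ continuous N, N 0 = 0, N b = 0 &
    forall x, 0 <= x <= b -> N x = - \int[mu]_(y in `[0, x]) m y].
Proof.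
move=> b0 im m0.
pose m1 := m \_ `[0, b].
have im1 (a c : R) : mu.-integrable `[a, c] (EFin \o m1).
  apply: (@integrableS _ _ _ _ setT) => //.
  by rewrite -restrict_EFin; apply/(integrable_mkcond _ _).1.
(* Starting at -1 makes 0 an interior point, so that continuity holds there on both sides. *)
pose M x := \int[mu]_(y in `[-1, x]) m1 y.
have ME x : 0 <= x <= b -> M x = \int[mu]_(y in `[0, x]) m y.
  move=> /andP[x0 xb]; rewrite /M /m1 -Rintegral_mkcondr; congr (Rintegral _ _ _).
  apply/seteqP; split=> z /=; rewrite !in_itv /=; first by move=> [/andP[_ ->] /andP[-> _]].
  by move=> /andP[z0 zx]; rewrite zx z0 (le_trans zx xb) (le_trans _ z0)// lerN10.
have cM x : -1 < x < b + 1 -> {for x, continuous M}.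
  have ab : -1 < b + 1 by lra.
  have /(continuous_within_itvP _ ab)[H _ _] :=
    parameterized_integral_continuous (ltW ab) (im1 _ _).
  by move=> xb; apply: H; rewrite inE.
pose cl x := Num.max 0 (Num.min x b).
have clE x : 0 <= x <= b -> cl x = x.
  by move=> /andP[x0 xb]; rewrite /cl (min_idPl xb) (max_idPr x0).
have ccl : continuous cl.
  move=> x; apply: (@continuous_max _ _ (fun=> 0) (fun x => Num.min x b)).
    exact: cvg_cst.
  by apply: continuous_min; [exact: cvg_id|exact: cvg_cst].
have NE x : 0 <= x <= b -> - M (cl x) = - \int[mu]_(y in `[0, x]) m y.
  by move=> xb; rewrite clE// ME.
exists (fun x => - M (cl x)); split => //.
- move=> x; apply: cvgN; apply: (@continuous_comp _ _ _ cl M); first exact: ccl.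
  apply: cM; rewrite /cl lt_max gt_max gt_min; apply/andP; split; first by apply/orP; left; lra.
  by apply/andP; split; [lra|apply/orP; right; lra].
- by rewrite NE ?lexx ?ltW// set_itv1 Rintegral_set1 oppr0.
- by rewrite NE ?lexx ?ltW// m0 oppr0.
Qed.

Lemma axial_rigidity (U : R -> R) (C : R) : measurable_fun `[0, pi] U ->
  mu.-integrable `[0, pi] (EFin \o (fun t => U t * sin t ^+ 3)) ->
  mu.-integrable `[0, pi]
    (EFin \o (fun t => (C * expR (4 * U t) - 30) * sin t ^+ 3)) ->
  (forall p, \int[mu]_(t in `[0, pi]) (U t * (zonal_paneitz p).[cos t] * sin t ^+ 3) =
    \int[mu]_(t in `[0, pi])
      ((C * expR (4 * U t) - 30) * p.[cos t] * sin t ^+ 3)) ->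
  exists c, {ae mu, forall t, 0 < t < pi -> U t = c}.
Proof.
move=> mU iU im wU; have p0 : 0 < pi :> R := pi_gt0 R.
pose m t := (C * expR (4 * U t) - 30) * sin t ^+ 3.
have wm p : \int[mu]_(t in `[0, pi]) (U t * (zonal_paneitz p).[cos t] * sin t ^+ 3) =
    \int[mu]_(t in `[0, pi]) (m t * p.[cos t]).
  by rewrite wU; apply: eq_Rintegral => t _; rewrite mulrAC.
(* The test polynomial 1 is killed by P_4; this is what makes [N] vanish at [pi]. *)
have m0 : \int[mu]_(t in `[0, pi]) m t = 0.
  have pan1 : zonal_paneitz 1 = 0 :> {poly R}.
    have d1 : (1 : {poly R})^`() = 0 by exact: derivC.
    by rewrite /zonal_paneitz /zonal_laplace d1 !(deriv0, mulr0, scaler0, subr0).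
  have -> : \int[mu]_(t in `[0, pi]) m t =
      \int[mu]_(t in `[0, pi]) (m t * (1 : {poly R}).[cos t]).
    by apply: eq_Rintegral => t _; rewrite hornerC mulr1.
  rewrite -wm pan1; under eq_Rintegral do rewrite horner0 mulr0 mul0r.
  by rewrite Rintegral_cst// mul0r.
have [N [cN N0 Npi NE]] := primitive_continuous_ext p0 im m0.
have wN p : \int[mu]_(t in `[0, pi]) (U t * (zonal_paneitz p).[cos t] * sin t ^+ 3) =
    - \int[mu]_(t in `[0, pi]) (N t * (p^`().[cos t] * sin t)).
  have ck : continuous (fun t : R => p^`().[cos t] * sin t).
    by move=> t; apply: cvgM; [exact: continuous_horner_cos|exact: continuous_sin].
  have dK (x : R) : is_derive x 1 (fun t => - p.[cos t]) (p^`().[cos x] * sin x).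
    by apply: der_eq (derN (der_horner_cos x p)) _; ring.
  have K := integral_primitive_mul p0 im ck dK.
  have iNk : mu.-integrable `[0, pi] (EFin \o (fun t => N t * (p^`().[cos t] * sin t))).
    apply: continuous_compact_integrable; first exact: segment_compact.
    by apply: continuous_subspaceT => t; apply: cvgM; [exact: cN|exact: ck].
  rewrite -mulN1r -RintegralZl// wm.
  have -> : \int[mu]_(t in `[0, pi]) (-1 * (N t * (p^`().[cos t] * sin t))) =
      \int[mu]_(t in `[0, pi]) (p^`().[cos t] * sin t * \int[mu]_(y in `[0, t]) m y).
    by apply: eq_Rintegral => t; rewrite inE /= in_itv /= => /NE ->; ring.
  rewrite K.
  have -> : \int[mu]_(y in `[0, pi]) (m y * (- p.[cos pi] - - p.[cos y])) =
      \int[mu]_(y in `[0, pi]) (m y * p.[cos y] - p.[cos pi] * m y).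
    by apply: eq_Rintegral => t _; ring.
  rewrite RintegralB//.
  - by rewrite RintegralZl// m0 mulr0 subr0.
  - exact: integrable_mulr_horner_cos.
  - exact: integrable_scaler.
have [F [D [D2 [V0 P0]]]] := profile_exists cN N0 Npi.
have [c UV] := profile_unique cN P0 iU wN.
have P := profile_addc c P0; pose V x := V0 x + c.
pose mV t := (C * expR (4 * V t) - 30) * sin t ^+ 3.
have cmV : {within `[0, pi], continuous mV}.
  have [E0 Epi] := profile_exp_cvg0 P.
  have lim (FF : set_system R) : Filter FF ->
      expR (4 * V x) * sin x ^+ 3 @[x --> FF] --> (0 : R) ->
      sin x @[x --> FF] --> (0 : R) -> mV x @[x --> FF] --> (0 : R).
    move=> ? e0 s0.
    have H : C * (expR (4 * V x) * sin x ^+ 3) - 30 * (sin x * (sin x * sin x)) @[x --> FF]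
        --> C * 0 - 30 * (0 * (0 * 0)).
      by apply: cvgB; apply: cvgM => //; [exact: cvg_cst|exact: cvg_cst|apply: cvgM => //; exact: cvgM].
    rewrite !mulr0 subr0 in H; apply: cvg_trans H; apply: near_eq_cvg; apply: nearW => x.
    by rewrite /mV; ring.
  apply: cvg_within_cc => //.
  - move=> x xp; apply: cvgM; last first.
      by have cs := @continuous_sin R x; exact: (cvgM cs (cvgM cs cs)).
    apply: cvgB; last exact: cvg_cst.
    exact: der_continuous (derM (der_cst x C)
      (der_comp (is_derive_expR _) (derM (der_cst x 4) (der_V P xp)))).
  - by rewrite [X in _ --> X]/mV sin0 expr0n mulr0; apply: lim E0 cvg_sin0.
  - rewrite [X in _ --> X]/mV sinpi expr0n mulr0; apply: lim Epi _.
    by apply: cvg_at_left_filter; rewrite -[X in _ --> X]sinpi; exact: continuous_sin.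
have imV : mu.-integrable `[0, pi] (EFin \o mV).
  by apply: continuous_compact_integrable => //; exact: segment_compact.
(* The bootstrap: [U] may be replaced by [V] under the integral, and unlike [m] the new integrand is
   continuous, so [N] becomes differentiable. *)
have NV x : 0 <= x <= pi -> N x = - \int[mu]_(y in `[0, x]) mV y.
  move=> /andP[x0 xp]; rewrite NE; last by rewrite x0.
  congr (- _); rewrite /Rintegral; congr fine.
  have sub : `[0, x]%classic `<=` (`[0, pi]%classic : set R).
    by apply: subset_itvl; rewrite bnd_simp.
  apply: ae_eq_integral => //.
  - by apply: (measurable_int mu); apply: integrableS im.
  - by apply: (measurable_int mu); apply: integrableS imV.
  - move: UV; apply: filterS; first exact: (ae_filter_ringOfSetsType mu).
    move=> t Ut; rewrite /= in_itv /= => /andP[t0 tx]; congr EFin; rewrite /m /mV.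
    (* [UV] says nothing at the end points, where both integrands vanish with sin. *)
    have [->|tn0] := eqVneq t 0; first by rewrite sin0 expr0n !mulr0.
    have [->|tnp] := eqVneq t pi; first by rewrite sinpi expr0n !mulr0.
    rewrite Ut// !lt_neqAle eq_sym tn0 t0 tnp /=; exact: le_trans xp.
have dN x : 0 < x < pi -> is_derive x 1 N (- sin x ^+ 3 * (C * expR (4 * V x) - 30)).
  move=> /andP[x0 xp].
  have cx : {for x, continuous mV}.
    have /(continuous_within_itvP _ p0)[H _ _] := cmV.
    by apply: H; rewrite inE; apply/andP.
  have [d1 d2] := continuous_FTC1_closed xp imV x0 cx.
  have d : is_derive x 1 (fun x => \int[mu]_(y in `[0, x]) mV y) (mV x).
    by split; [exact: d1|rewrite -derive1E; exact: d2].
  apply: (@near_eq_is_derive _ _ _ (fun x => - \int[mu]_(y in `[0, x]) mV y)).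
    near=> z; rewrite NV//; apply/andP; split; apply/ltW; near: z.
      exact: lt_nbhsr.
    exact: lt_nbhsl.
  by apply: der_eq (derN d) _; rewrite /mV; ring.
have Vc := profile_rigid cN N0 Npi P dN.
exists (V (pi / 2)); move: UV; apply: filterS; first exact: (ae_filter_ringOfSetsType mu).
move=> t Ut tp; rewrite Ut//; apply: Vc => //.
by apply/andP; split; lra.
Unshelve. all: by end_near. Qed.

End one_dimensional.

(** * Reduction to one dimension *)

Section sphere_reduction.
Context {R : realType}.
Notation mu := (@lebesgue_measure R).
Local Notation angles := (measurableTypeR R * measurableTypeR R *
                           measurableTypeR R * measurableTypeR R)%type.
Implicit Types (h k : R -> R) (z : angles).

(** The left-nested form in which the lemmas on product measures apply once per angle; [cst 1] is
    the factor in the last angle. *)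
Definition angle_tensor h z : R :=
  h z.1.1.1 * sin z.1.1.2 ^+ 2 * sin z.1.2 * cst 1 z.2.

Lemma angle_tensorE k z :
  k z.1.1.1 * polar_density z = angle_tensor (fun x => k x * sin x ^+ 3) z.
Proof.
by case: z => [[[t1 t2] t3] t4]; rewrite /angle_tensor /=; ring.
Qed.

Lemma integrable_cc (a b : R) (f : R -> R) : continuous f ->
  mu.-integrable `[a, b] (EFin \o f).
Proof.
move=> cf; apply: continuous_compact_integrable; first exact: segment_compact.
exact: continuous_subspaceT.
Qed.

Lemma continuous_sinX n : continuous (fun x : R => sin x ^+ n).
Proof.
elim: n => [|n IH] x; first exact: cvg_cst.
rewrite (_ : (fun x : R => sin x ^+ n.+1) = fun x => sin x * sin x ^+ n).
  by apply: cvgM; [exact: continuous_sin|exact: IH].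
by apply/funext => y; rewrite exprS.
Qed.

Lemma integral_sin1 : \int[mu]_(x in `[0, pi]) sin x = 2.
Proof.
have d (x : R) : 0 < x < pi -> is_derive x 1 (fun t => - cos t) (sin x).
  by move=> _; apply: der_eq (derN (is_derive_cos x)) _; rewrite opprK.
have c x : {for x, continuous (fun t : R => - cos t)} by apply: cvgN; exact: continuous_cos.
rewrite (FTC2_oo (pi_gt0 R) (continuous_subspaceT (@continuous_sin R)) d
  (cvg_at_right_filter (c 0)) (cvg_at_left_filter (c pi))).
by rewrite cos0 cospi; lra.
Qed.

Lemma integral_sin2 : \int[mu]_(x in `[0, pi]) (sin x ^+ 2) = pi / 2.
Proof.
pose P (t : R) : R := (t - sin t * cos t) / 2.
have d (x : R) : is_derive x 1 P (sin x ^+ 2).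
  apply: der_eq (derM (derB (is_derive_id x 1)
    (derM (is_derive_sin x) (is_derive_cos x))) (der_cst x 2^-1)) _.
  by move: (cos2Dsin2 x) => H; nra.
rewrite (FTC2_oo (pi_gt0 R) (continuous_subspaceT (@continuous_sinX 2)) (fun x _ => d x)
  (cvg_at_right_filter (der_continuous (d 0))) (cvg_at_left_filter (der_continuous (d pi)))).
by rewrite /P sin0 sinpi !mul0r !subr0; lra.
Qed.

Lemma integral_angle4 : \int[mu]_(x in `[0, 2 * pi]) (cst 1 x : R) = 2 * pi.
Proof.
rewrite /cst Rintegral_cst// mul1r [X in fine X]lebesgue_measure_itv/= lte_fin.
by rewrite mulr_gt0 ?pi_gt0// -EFinD /= subr0.
Qed.

Let mu2 := sigma_finite_product mu mu.
Let mu3 := sigma_finite_product mu2 mu.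

Let mI : measurable (`[0%R, pi]%classic : set (measurableTypeR R)). Proof. by []. Qed.
Let mJ : measurable (`[0%R, 2 * pi]%classic : set (measurableTypeR R)). Proof. by []. Qed.
Let mI2 := measurableX mI mI.
Let mI3 := measurableX mI2 mI.

Lemma measurable_polar_domain : measurable (polar_domain : set angles).
Proof. exact: (measurableX mI3 mJ). Qed.

Let i2 : mu.-integrable `[0, pi] (EFin \o (fun x : R => sin x ^+ 2)).
Proof. by apply: integrable_cc; exact: continuous_sinX. Qed.
Let i1 : mu.-integrable `[0, pi] (EFin \o (sin : R -> R)).
Proof. by apply: integrable_cc; exact: continuous_sin. Qed.
Let i0 : mu.-integrable `[0, 2 * pi] (EFin \o (cst 1 : R -> R)).
Proof. by apply: integrable_cc; exact: cst_continuous. Qed.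

Lemma integrable_angle_tensor h : mu.-integrable `[0, pi] (EFin \o h) ->
  leb4.-integrable polar_domain (EFin \o angle_tensor h).
Proof.
move=> ih.
have K2 := @integrable_tensor _ _ _ _ _ mu mu _ _ _ _ mI mI ih i2.
have K3 := @integrable_tensor _ _ _ _ _ mu2 mu _ _ _ _ mI2 mI K2 i1.
exact: (@integrable_tensor _ _ _ _ _ mu3 mu _ _ _ _ mI3 mJ K3 i0).
Qed.

Lemma Rintegral_angle_tensor h : mu.-integrable `[0, pi] (EFin \o h) ->
  Rintegral leb4 polar_domain (angle_tensor h) =
  \int[mu]_(x in `[0, pi]) h x * (2 * pi ^+ 2).
Proof.
move=> ih.
have K2 := @integrable_tensor _ _ _ _ _ mu mu _ _ _ _ mI mI ih i2.
have K3 := @integrable_tensor _ _ _ _ _ mu2 mu _ _ _ _ mI2 mI K2 i1.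
have E2 := @Rintegral_tensor _ _ _ _ _ mu mu _ _ _ _ mI mI ih i2.
have E3 := @Rintegral_tensor _ _ _ _ _ mu2 mu _ _ _ _ mI2 mI K2 i1.
have E4 := @Rintegral_tensor _ _ _ _ _ mu3 mu _ _ _ _ mI3 mJ K3 i0.
(* The integrals over t2, t3 and t4, kept apart; their product 2 pi^2 is the volume of S^3. *)
transitivity (\int[mu]_(x in `[0, pi]) h x * (pi / 2) * 2 * (2 * pi)); last by field.
rewrite -[X in _ = _ * X * _ * _]integral_sin2 -[X in _ = _ * X * _]integral_sin1.
by rewrite -[X in _ = _ * X]integral_angle4 -[X in _ = X * _ * _]E2 -[X in _ = X * _]E3 -[RHS]E4.
Qed.

Let g2 : measurable_fun `[0, pi] (fun x : R => sin x ^+ 2).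
Proof. by apply/measurable_EFinP; exact: (measurable_int mu i2). Qed.
Let g1 : measurable_fun `[0, pi] (sin : R -> R).
Proof. by apply/measurable_EFinP; exact: (measurable_int mu i1). Qed.

Lemma measurable_angle_tensor h : measurable_fun `[0, pi] h ->
  measurable_fun polar_domain (angle_tensor h).
Proof.
move=> mh; have M2 := measurable_tensor_on mI mI mh g2.
have M3 := measurable_tensor_on mI2 mI M2 g1.
exact: (measurable_tensor_on mI3 mJ M3 (@measurable_cst _ _ _ _ `[0%R, 2 * pi]%classic (1 : R))).
Qed.

Lemma integrable_angle_tensorP h : measurable_fun `[0, pi] h ->
  leb4.-integrable polar_domain (EFin \o angle_tensor h) ->
  mu.-integrable `[0, pi] (EFin \o h).
Proof.
move=> mh ih; have p0 := pi_gt0 R.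
have M2 := measurable_tensor_on mI mI mh g2.
have M3 := measurable_tensor_on mI2 mI M2 g1.
have K3 := @integrable_tensor_l _ _ _ _ _ mu3 mu _ _ _ _ mI3 mJ M3 i0 _ ih.
have K2 := @integrable_tensor_l _ _ _ _ _ mu2 mu _ _ _ _ mI2 mI M2 i1 _ (K3 _).
apply: (@integrable_tensor_l _ _ _ _ _ mu mu _ _ _ _ mI mI mh i2 _ (K2 _ _)).
- by rewrite [X in X != 0]integral_sin2 gt_eqF// divr_gt0.
- by rewrite [X in X != 0]integral_sin1.
- by rewrite [X in X != 0]integral_angle4 gt_eqF// mulr_gt0.
Qed.

Lemma ae_exists (A : set (measurableTypeR R)) (P : R -> Prop) : measurable A ->
  mu A != 0%E -> {ae mu, forall x, P x} -> exists2 x, A x & P x.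
Proof.
move=> mA A0 [N [mN N0 PN]]; apply: contrapT => H.
move/negP: A0; apply; rewrite -measure_le0 -N0; apply: le_measure; rewrite ?inE//.
by move=> x Ax; apply: PN => /= Px; apply: H; exists x.
Qed.

Lemma measurable_angle1 k : measurable_fun setT k ->
  measurable_fun polar_domain (fun z : angles => k z.1.1.1).
Proof.
move=> mk; apply: measurable_funTS.
have m3 : measurable_fun setT (fun z : angles => z.1.1.1).
  exact: (measurableT_comp measurable_fst (measurableT_comp measurable_fst measurable_fst)).
exact: (measurableT_comp mk m3).
Qed.

(* A section of [u o polar] at almost every [t2, t3, t4] is measurable, while the
   function given by zonal symmetry need not be. *)
Lemma axial_profile (u : 'rV[R]_5 -> R) :
  measurable_fun polar_domain (u \o polar) -> axially_symmetric u ->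
  exists U : R -> R, measurable_fun `[0, pi] U /\
    {ae leb4, forall z, polar_domain z -> u (polar z) = U z.1.1.1}.
Proof.
move=> mu_ [g Hg]; have p0 := pi_gt0 R.
pose P z := polar_domain z -> u (polar z) = g (cos z.1.1.1).
have HP : {ae leb4, forall z, P z}.
  move: Hg; rewrite /sphere_ae; apply: filterS.
  by move=> z H Dz; rewrite H// polar0.
have mesI : mu `[0, pi] != 0%E.
  by rewrite [X in X != _]lebesgue_measure_itv/= lte_fin p0 oppr0 addr0 eqe gt_eqF.
have mesJ : mu `[0, 2 * pi] != 0%E.
  by rewrite [X in X != _]lebesgue_measure_itv/= lte_fin mulr_gt0// oppr0 addr0 eqe gt_eqF// mulr_gt0.
have H4 := @ae_ysection _ _ _ _ _ mu3 mu _ HP.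
have [t4 J4 H3'] := ae_exists mJ mesJ H4.
have H3 := @ae_ysection _ _ _ _ _ mu2 mu _ H3'.
have [t3 I3 H2'] := ae_exists mI mesI H3.
have H2 := @ae_ysection _ _ _ _ _ mu mu _ H2'.
have [t2 I2 H1] := ae_exists mI mesI H2.
exists (fun x => u (polar (x, t2, t3, t4))); split.
  apply: (@measurable_comp _ _ _ _ _ _ (polar_domain : set angles) (u \o polar)
    `[0, pi] (fun x => (x, t2, t3, t4))) => //.
  - exact: measurable_polar_domain.
  - by move=> _ [x Ix <-].
  - apply: measurable_funTS; apply: measurable_fun_pair => //.
    by apply: measurable_fun_pair => //; apply: measurable_fun_pair.
have H1' := @ae_fst _ _ _ _ _ mu3 mu _ (@ae_fst _ _ _ _ _ mu2 mu _ (@ae_fst _ _ _ _ _ mu mu _ H1)).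
move: HP H1'; apply: filterS2.
move=> [[[x1 x2] x3] x4] /= HPz H1z Dz.
rewrite HPz//= H1z//=.
by case: Dz => [[[? ?] ?] ?].
Qed.

Lemma ae_polar_density (f : 'rV[R]_5 -> R) k :
  {ae leb4, forall z, polar_domain z -> f (polar z) = k z.1.1.1} ->
  ae_eq leb4 polar_domain (EFin \o (fun z => f (polar z) * polar_density z))
    (EFin \o angle_tensor (fun x => k x * sin x ^+ 3)).
Proof.
apply: filterS.
by move=> z H Dz; rewrite /= -angle_tensorE H.
Qed.

Lemma measurable_polar_density (f : 'rV[R]_5 -> R) :
  measurable_fun polar_domain (f \o polar) ->
  measurable_fun polar_domain (EFin \o (fun z => f (polar z) * polar_density z)).
Proof.
move=> mf; apply/measurable_EFinP; apply: measurable_funM => //.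
rewrite (_ : @polar_density R = angle_tensor (fun x => sin x ^+ 3)).
  by apply: measurable_angle_tensor; apply: measurable_funTS;
    apply: continuous_measurable_fun; exact: continuous_sinX.
by apply/funext => z; case: z => [[[t1 t2] t3] t4]; rewrite /angle_tensor /=; ring.
Qed.

(** The factor 2 pi^2 of the other angles cancels in the quotient, and 3 / 4 is the inverse of the
    integral of sin^3. *)
Lemma sphere_int_axial (f : 'rV[R]_5 -> R) k :
  measurable_fun polar_domain (f \o polar) ->
  {ae leb4, forall z, polar_domain z -> f (polar z) = k z.1.1.1} ->
  mu.-integrable `[0, pi] (EFin \o (fun x => k x * sin x ^+ 3)) ->
  sphere_int f = (\int[mu]_(x in `[0, pi]) (k x * sin x ^+ 3)) * (3 / 4).
Proof.
move=> mf fk ik; have p0 := pi_gt0 R; rewrite /sphere_int.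
have -> : Rintegral leb4 polar_domain (@polar_density R) = 4 / 3 * (2 * pi ^+ 2).
  rewrite -[X in _ = X * _]integral_sin3 -Rintegral_angle_tensor.
    by apply: eq_Rintegral => z _; case: z => [[[t1 t2] t3] t4]; rewrite /angle_tensor /=; ring.
  by apply: integrable_cc; exact: continuous_sinX.
have -> : Rintegral leb4 polar_domain (fun z => f (polar z) * polar_density z) =
    Rintegral leb4 polar_domain (angle_tensor (fun x => k x * sin x ^+ 3)).
  congr fine; apply: ae_eq_integral.
  - exact: measurable_polar_domain.
  - exact: measurable_polar_density.
  - exact: (measurable_int leb4 (integrable_angle_tensor ik)).
  - exact: ae_polar_density.
rewrite Rintegral_angle_tensor//.
move: (Rintegral mu _ _) => J; move: (pi : R) p0 => q q0.
by field; rewrite gt_eqF.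
Qed.

Lemma integrable_axial (f : 'rV[R]_5 -> R) k : measurable_fun `[0, pi] k ->
  {ae leb4, forall z, polar_domain z -> f (polar z) = k z.1.1.1} ->
  leb4.-integrable polar_domain (EFin \o (fun z => f (polar z) * polar_density z)) ->
  mu.-integrable `[0, pi] (EFin \o (fun x => k x * sin x ^+ 3)).
Proof.
move=> mk fk /integrableP[mf If].
have ms : measurable_fun `[0, pi] (fun x => k x * sin x ^+ 3).
  apply: measurable_funM => //; apply: measurable_funTS.
  by apply: continuous_measurable_fun; exact: continuous_sinX.
have mt : measurable_fun polar_domain (EFin \o angle_tensor (fun x => k x * sin x ^+ 3)).
  by apply/measurable_EFinP; exact: measurable_angle_tensor.
apply: integrable_angle_tensorP => //; apply/integrableP; split => //.
move: If; congr (_ < _)%E; apply: ae_eq_integral.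
- exact: measurable_polar_domain.
- exact: measurableT_comp.
- exact: measurableT_comp.
- by apply: ae_eq_abse; exact: ae_polar_density.
Qed.

End sphere_reduction.

Theorem theorem1p3 (R : realType) (alpha : R) (halpha : alpha = 1 / 5)
  (u : 'rV[R]_5 -> R) (hH2 : sphere_H2 u) (haxi : axially_symmetric u)
  (hsol : weak_solution alpha u) :
  exists c : R, sphere_ae (fun x => u x = c).
Proof.
case: hH2 => -[mu_ iu2] _; have p0 := pi_gt0 R.
pose mu := @lebesgue_measure R.
have mI : measurable (`[0%R, pi]%classic : set (measurableTypeR R)) by [].
have [U [mU uU]] := axial_profile mu_ haxi.
have s0 t : t \in `[0, pi] -> 0 <= sin t ^+ 3 :> R.
  by move=> t0p; rewrite exprn_ge0// sin_ge0_pi.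
have ms3 : measurable_fun `[0, pi] (fun x : R => sin x ^+ 3).
  by apply: measurable_funTS; apply: continuous_measurable_fun; exact: continuous_sinX.
have is3 : mu.-integrable `[0, pi] (EFin \o (fun x : R => sin x ^+ 3)).
  by apply: integrable_cc; exact: continuous_sinX.
have iU2 : mu.-integrable `[0, pi] (EFin \o (fun x => U x ^+ 2 * sin x ^+ 3)).
  apply: (@integrable_axial _ (fun x => u x ^+ 2) (fun x => U x ^+ 2)) => //.
    exact: measurable_funX.
  by move: uU; apply: filterS => z H Dz; rewrite H.
have iU : mu.-integrable `[0, pi] (EFin \o (fun x => U x * sin x ^+ 3)).
  apply: (le_integrable mI _ _ (integrable_addr mI iU2 is3)).
    by apply/measurable_EFinP; exact: measurable_funM.
  move=> x x0p; rewrite /= lee_fin.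
  have h := s0 x x0p; rewrite normrM (ger0_norm h).
  (* This gives |U| <= U^2 + 1/4, which the integrable function (U^2 + 1) sin^3 dominates once
     weighted. *)
  have U0 : 0 <= (`|U x| - 2^-1) ^+ 2 by exact: sqr_ge0.
  have E : `|U x| ^+ 2 = U x ^+ 2 by rewrite real_normK ?num_real.
  by apply: le_trans (ler_norm _); nra.
pose gam := sphere_int (fun y => expR (4 * u y)).
have mexp : measurable_fun `[0, pi] (fun x => expR (4 * U x)).
  by apply: (measurableT_comp (@measurable_expR R)); apply: measurable_funM.
have iE : gam != 0 -> mu.-integrable `[0, pi]
    (EFin \o (fun x => expR (4 * U x) * sin x ^+ 3)).
  move=> g0; apply: (@integrable_axial _ (fun x => expR (4 * u x))
    (fun x => expR (4 * U x))) => //.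
    by move: uU; apply: filterS => z H Dz; rewrite H.
  have mf : measurable_fun polar_domain
      (EFin \o (fun z => expR (4 * u (polar z)) * polar_density z)).
    apply: (@measurable_polar_density _ (fun x => expR (4 * u x))).
    by apply: (measurableT_comp (@measurable_expR R)); apply: measurable_funM.
  apply/integrableP; split => //.
  (* The integrand is nonnegative, so failure of integrability means that its integral is [+oo],
     which [fine] sends to 0, against [gam != 0]. *)
  rewrite ltey; apply/eqP => E; move: g0; rewrite /gam /sphere_int /Rintegral.
  rewrite (_ : (\int[leb4]_(x in polar_domain) _)%E = +oo%E) ?mul0r ?eqxx//.
  rewrite -[RHS]E; apply: eq_integral => z; rewrite inE => Dz /=.
  rewrite ger0_norm// mulr_ge0 ?expR_ge0//.
  case: z Dz => [[[t1 t2] t3] t4] /= [[[h1 h2] h3] _].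
  by rewrite mulr_ge0 ?sin_ge0_pi// mulr_ge0 ?sqr_ge0// exprn_ge0// sin_ge0_pi.
(* 30 is 6 / alpha. If [gam] is 0, so is its inverse, and [C] is 0. *)
pose C := 30 / gam.
have im : mu.-integrable `[0, pi]
    (EFin \o (fun t => (C * expR (4 * U t) - 30) * sin t ^+ 3)).
  rewrite (_ : (fun t => _) =
      (fun t => C * (expR (4 * U t) * sin t ^+ 3) - 30 * sin t ^+ 3)); last first.
    by apply/funext => t; ring.
  apply: integrable_subr => //; last exact: integrable_scaler.
  have [g0|g0] := eqVneq gam 0; last by apply: integrable_scaler => //; exact: iE.
  rewrite /C g0 invr0 mulr0 (_ : (fun t => _) = cst 0).
    by apply: integrable_cc; exact: cst_continuous.
  by apply/funext => t; rewrite mul0r.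
have iw p : mu.-integrable `[0, pi]
    (EFin \o (fun t => (1 - expR (4 * U t) / gam) * p.[cos t] * sin t ^+ 3)).
  rewrite (_ : (fun t => _) = (fun t => - 30^-1 *
      ((C * expR (4 * U t) - 30) * sin t ^+ 3 * p.[cos t]))).
    by apply: integrable_scaler => //; exact: integrable_mulr_horner_cos.
  apply/funext => t; rewrite /C; move: (gam^-1) (expR _) => g e.
  by field.
have wU p : \int[mu]_(t in `[0, pi]) (U t * (zonal_paneitz p).[cos t] * sin t ^+ 3) =
    \int[mu]_(t in `[0, pi]) ((C * expR (4 * U t) - 30) * p.[cos t] * sin t ^+ 3).
  have := hsol (zonal p) (smooth_zonal p).
  have mp q : measurable_fun (polar_domain : set _) (fun z => q.[cos z.1.1.1] : R).
    by apply: (@measurable_angle1 _ (fun x => q.[cos x])); exact: measurable_horner_cos.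
  have mpan : measurable_fun polar_domain ((paneitz (zonal p)) \o polar).
    rewrite (_ : _ \o _ = fun z => (zonal_paneitz p).[cos z.1.1.1]) //.
    by apply/funext => z; rewrite /= paneitz_zonal ?sqnorm_polar// polar0.
  have max : measurable_fun polar_domain ((zonal p) \o polar).
    rewrite (_ : _ \o _ = fun z => p.[cos z.1.1.1]) //.
    by apply/funext => z; rewrite /= /zonal polar0.
  rewrite (@sphere_int_axial _ _ (fun t => U t * (zonal_paneitz p).[cos t])).
  - rewrite (@sphere_int_axial _ _ (fun t => (1 - expR (4 * U t) / gam) * p.[cos t])).
    + move=> H.
      have -> : \int[mu]_(t in `[0, pi])
          ((C * expR (4 * U t) - 30) * p.[cos t] * sin t ^+ 3) =
         - 30 * \int[mu]_(t in `[0, pi])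
          ((1 - expR (4 * U t) / gam) * p.[cos t] * sin t ^+ 3).
        rewrite -RintegralZl//.
          by apply: eq_Rintegral => t _; rewrite /C; ring.
      by move: H; rewrite halpha; move: (Rintegral _ _ _) (Rintegral _ _ _) => a b; lra.
    + apply: measurable_funM => //; apply: measurable_funB => //.
      apply: measurable_funM => //; apply: (measurableT_comp (@measurable_expR R)).
      exact: measurable_funM.
    + move: uU; apply: filterS => z H Dz.
      by rewrite H// /zonal polar0.
    + exact: iw.
  - exact: measurable_funM.
  - move: uU; apply: filterS => z H Dz.
    by rewrite H// paneitz_zonal ?sqnorm_polar// polar0.
  - rewrite (_ : (fun t => _) = (fun t => U t * sin t ^+ 3 * (zonal_paneitz p).[cos t])).
      exact: integrable_mulr_horner_cos.
    by apply/funext => t; rewrite mulrAC.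
have [c Uc] := axial_rigidity mU iU im wU.
(* The poles are a null set; the closed range is the one that [polar_domain] prescribes for the
   first angle. *)
have Uc' : {ae mu, forall t, 0 <= t <= pi -> U t = c}.
  have ne (r : R) : {ae mu, forall t, t != r}.
    exists [set r]; split => //; first exact: lebesgue_measure_set1.
    by move=> t /= /negP; rewrite negbK => /eqP.
  have n2 : {ae mu, forall t, t != 0 /\ t != pi}.
    move: (ne 0) (ne pi); apply: filterS2; first exact: (ae_filter_ringOfSetsType mu).
    by [].
  move: Uc n2; apply: filterS2; first exact: (ae_filter_ringOfSetsType mu).
  move=> t Ut [t0 tp] /andP[t0' tp']; apply: Ut.
  by rewrite !lt_neqAle eq_sym t0 t0' tp tp'.
exists c; rewrite /sphere_ae.
have H := @ae_fst _ _ _ _ _ (sigma_finite_product (sigma_finite_product mu mu) mu) mu _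
  (@ae_fst _ _ _ _ _ (sigma_finite_product mu mu) mu _ (@ae_fst _ _ _ _ _ mu mu _ Uc')).
move: uU H; apply: filterS2 => -[[[t1 t2] t3] t4] /= Hu Hc Dz.
rewrite Hu//= Hc//=.
by case: Dz => [[[]]].
Qed.
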